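(* The approximations $\psi:\ell\to HC^-_*$, $\psi^{per}:\ell^{per}\to HC^{per}_*$ and $\psi^+:\ell^+\to HC_*$ are universal in the following sense. Let $F$, $F^{per}$ be functors from unital (graded) commutative $\mathbb F_2$-algebras of finite type to unital graded commutative $\mathbb F_2$-algebras, and $F^+$ a functor from unital (graded) commutative $\mathbb F_2$-algebras of finite type to graded $\mathbb F_2$-vector spaces, together with natural transformations $$f:F\to HC^-_*,\qquad f^{per}:F^{per}\to HC^{per}_*,\qquad f^+:F^+\to HC_*$$ which are isomorphisms when evaluated on polynomial algebras. Then there are natural transformations $e:\ell\to F$, $e^{per}:\ell^{per}\to F^{per}$ and $e^+:\ell^+\to F^+$ such that $$f\circ e=\psi,\qquad f^{per}\circ e^{per}=\psi^{per},\qquad f^+\circ e^+=\psi^+.$$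
   Context: Conventions. $k=\mathbb F_2$; algebras are possibly non-negatively graded, $|a|$ is upper degree; an ungraded algebra is concentrated in degree $0$. $A$ is of finite type if it is generated as an algebra by homogeneous elements, finitely many in each degree (finitely generated, in the ungraded case). $\ell(A)$ is the free commutative unital $k$-algebra on generators $\delta(a),\phi(a),q(a)$ ($a\in A$) and $u$ modulo, for all $a,b,c\in A$: $\phi(a+b)=\phi(a)+\phi(b)$; $\delta(a+b)=\delta(a)+\delta(b)$; $q(a+b)=q(a)+q(b)+\delta(ab)$; $\delta(ab)\delta(c)+\delta(bc)\delta(a)+\delta(ca)\delta(b)=0$; $\phi(ab)=\phi(a)\phi(b)+uq(a)q(b)$; $q(ab)=q(a)\phi(b)+\phi(a)q(b)$; $\delta(a)^2=0$; $q(a)^2=0$; $\delta(a)\phi(b)=\delta(ab^2)$; $\delta(a)q(b)=\delta(ab)\delta(b)$; $u\delta(a)=0$; $\phi(1)=1$. $\ell^+(A)$ is the free $\ell(A)$-module on generators $\gamma(a)$ ($a\in A$) and $v^i$ ($i\ge0$) modulo: $\gamma(a+b)=\gamma(a)+\gamma(b)$; $\phi(a)\gamma(b)=\gamma(a^2b)$; $q(a)\gamma(b)=\delta(a)\gamma(ab)$; $\delta(a)\gamma(b)=\gamma(a)\delta(b)$; $\gamma(a)\delta(bc)+\gamma(ab)\delta(c)+\gamma(ac)\delta(b)=0$; $u\gamma(a)=0$; $\delta(a)v^i=0$ ($i\ge0$); $uv^i=v^{i-1}$ ($i\ge1$); $\gamma(1)=v^0$. $\ell^{per}(A)$ is the free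 commutative unital $k$-algebra on generators $\phi(a),q(a)$ ($a\in A$), $u,u^{-1}$ modulo: $\phi(a+b)=\phi(a)+\phi(b)$; $q(a+b)=q(a)+q(b)$; $\phi(ab)=\phi(a)\phi(b)+uq(a)q(b)$; $q(ab)=q(a)\phi(b)+\phi(a)q(b)$; $q(a)^2=0$; $uu^{-1}=1$; $\phi(1)=1$. Homological degrees: $\delta(a),\phi(a),q(a),u,u^{-1},\gamma(a),v^i$ have $1,0,1,-2,2,0,2i$; upper degrees: $|a|-1,2|a|,2|a|-1,2,-2,|a|,-2i$. Homologies. $\overline A=A/k$, $C_n(A)=A\otimes\overline A^{\otimes n}$ for $n\ge0$ ($0$ otherwise), $a_0[a_1|\cdots|a_n]=a_0\otimes\cdots\otimes a_n$ of homological degree $n$ and upper degree $\sum|a_i|-n$, $b(a_0[a_1|\cdots|a_n])=a_0a_1[a_2|\cdots|a_n]+\sum_{i=1}^{n-1}a_0[a_1|\cdots|a_ia_{i+1}|\cdots|a_n]+a_na_0[a_1|\cdots|a_{n-1}]$, $B(a_0[a_1|\cdots|a_n])=\sum_{i=0}^n1[a_i|\cdots|a_n|a_0|\cdots|a_{i-1}]$. $HC^-_*,HC_*,HC^{per}_*$ are the homologies of $C^-_n=\prod_{i\ge0}u^i\otimes C_{n+2i}(A)$, $C^+_n=\bigoplus_{i\le0}u^i\otimes C_{n+2i}(A)$, $C^{per}_n=\prod_{i\in\mathbb Z}u^i\otimes C_{n+2i}(A)$ with differential $b+uB$ (positive powers of $u$ are zero in $C^+$; for graded $A$ products are taken in each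 upper degree). The formula $$(u^i\otimes a_0[a_1|\cdots|a_p])\cdot(u^j\otimes b_0[b_1|\cdots|b_q])=u^{i+j}\otimes\sum_{\sigma\in S(p,q)}\sigma\cdot a_0b_0[a_1|\cdots|a_p|b_1|\cdots|b_q]+u^{i+j+1}\otimes\sum_{\sigma\in CS(p+1,q+1)}\sigma^{-1}\cdot1[a_0|\cdots|a_p|b_0|\cdots|b_q]$$ induces products on $HC^-_*(A)$ and $HC^{per}_*(A)$ and an $HC^-_*(A)$-module structure on $HC_*(A)$. Here $\sigma\cdot a_0[a_1|\cdots|a_n]=a_0[a_{\sigma^{-1}(1)}|\cdots|a_{\sigma^{-1}(n)}]$, $S(p,q)$ is the set of $(p,q)$-shuffles, $CS(p,q)$ the set of $\sigma\in S(p+q)$ such that $(\sigma(1),\dots,\sigma(p+q))$ is a shuffle of a cyclic permutation of $(1,\dots,p)$ with a cyclic permutation of $(p+1,\dots,p+q)$ in which $1$ appears before $p+1$. The approximations. $\psi:\ell(A)\to HC^-_*(A)$ is the algebra homomorphism $\delta(a)\mapsto1\otimes1[a]$, $q(a)\mapsto1\otimes a[a]$, $\phi(a)\mapsto1\otimes a^2[]+u\otimes1[a|a]$, $u\mapsto u\otimes1[]$. $\psi^{per}:\ell^{per}(A)\to HC^{per}_*(A)$ is the algebra homomorphism given by the same formulas on $q(a),\phi(a),u$ and $u^{-1}\mapsto u^{-1}\otimes1[]$. $\psi^+:\ell^+(A)\to HC_*(A)$ is the $\ell(A)$-linear map (with $\ell(A)$ acting on $HC_*(A)$ via $\psi$)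 with $\gamma(a)\mapsto1\otimes a[]$, $v^i\mapsto u^{-i}\otimes1[]$. *)

(* Defs.v *)
From HB Require Import structures.
From Stdlib Require List.
From mathcomp Require Import all_boot all_fingroup all_algebra finmap.
From mathcomp Require Import boolp classical_sets functions fsbigop.
From mathcomp.multinomials Require Import monalg.

Set Warnings "-notation-overridden,-ambiguous-paths,-notation-incompatible-prefix,-redundant-canonical-projection".
Set Implicit Arguments.
Unset Strict Implicit.
Unset Printing Implicit Defensive.

Import generic_quotient GRing.Theory.
Local Open Scope ring_scope.

(* Vector spaces over F_2 are abelian groups V with x + x = 0 in V, and
   commutative F_2-algebras are commutative rings (the zero ring included) with
   1 + 1 = 0; in both cases F_2-linear just means additive. *)

Record is_grading (I : choiceType) (V : zmodType) (P : I -> V -> Prop) : Prop :=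
  IsGrading {
    grading0 : forall i, P i 0;
    gradingB : forall i x y, P i x -> P i y -> P i (x - y);
    grading_span : forall v, exists (r : seq I) (x : I -> V),
      (forall i, P i (x i)) /\ v = \sum_(i <- r) x i;
    grading_direct : forall (r : seq I) (x : I -> V), uniq r ->
      (forall i, P i (x i)) -> \sum_(i <- r) x i = 0 ->
      forall i, i \in r -> x i = 0
  }.

Record gr_alg (I : nmodType) := GrAlg {
  ga_sort :> comPzRingType;
  ga_char2 : 1 + 1 = 0 :> ga_sort;
  ga_piece : I -> ga_sort -> Prop;
  ga_grading : is_grading ga_piece;
  ga_piece1 : ga_piece 0 1;
  ga_pieceM : forall i j x y,
    ga_piece i x -> ga_piece j y -> ga_piece (i + j) (x * y)
}.

Record gr_alg_hom (I : nmodType) (A B : gr_alg I) := GrAlgHom {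
  gah_fun :> {rmorphism A -> B};
  gah_piece : forall i x, ga_piece i x -> ga_piece i (gah_fun x)
}.

Record gr_mod (I : nmodType) := GrMod {
  gm_sort :> zmodType;
  gm_char2 : forall x : gm_sort, x + x = 0;
  gm_piece : I -> gm_sort -> Prop;
  gm_grading : is_grading gm_piece
}.

Record gr_mod_hom (I : nmodType) (V W : gr_mod I) := GrModHom {
  gmh_fun :> {additive V -> W};
  gmh_piece : forall i x, gm_piece i x -> gm_piece i (gmh_fun x)
}.

Definition generated_by (A : comPzRingType) (S : A -> Prop) : Prop :=
  forall T : A -> Prop,
    T 1 -> (forall x y, T x -> T y -> T (x - y)) ->
    (forall x y, T x -> T y -> T (x * y)) ->
    (forall x, S x -> T x) -> forall x, T x.

Definition finite_type (A : gr_alg nat) : Prop :=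
  exists gen : nat -> seq A,
    (forall s x, x \in gen s -> ga_piece s x) /\
    generated_by (fun x => exists s, x \in gen s).

(* The (non-negatively, upper) graded algebras of finite type, and when
   [ungraded] holds only those concentrated in degree 0. *)
Record ft_alg (ungraded : bool) := FtAlg {
  fta_alg :> gr_alg nat;
  fta_finite : finite_type fta_alg;
  fta_ungraded : ungraded -> forall x : fta_alg, ga_piece 0%N x
}.

Definition poly_eval (A : comPzRingType) (I : choiceType) (x : I -> A)
    (p : {malg 'F_2[{cmonom I}]}) : A :=
  \sum_(m <- msupp p) (\prod_(i <- finsupp m) x i ^+ m i) *+ (p@_m).

(* n s is the number of polynomial generators of degree s. *)
Definition is_polynomial (A : gr_alg nat) : Prop :=
  exists (n : nat -> nat) (x : {s : nat & 'I_(n s)} -> A),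
    (forall i, ga_piece (tag i) (x i)) /\ bijective (poly_eval x).

(* Functoriality is stated up to extensional equality of homomorphisms. *)
Record alg_functor (ungraded : bool) (G : zmodType) := AlgFunctor {
  af_obj :> ft_alg ungraded -> gr_alg G;
  af_map : forall A B : ft_alg ungraded,
    gr_alg_hom A B -> gr_alg_hom (af_obj A) (af_obj B);
  af_id : forall (A : ft_alg ungraded) (h : gr_alg_hom A A),
    h =1 id -> af_map h =1 id;
  af_comp : forall (A B C : ft_alg ungraded) (h : gr_alg_hom A B)
      (k : gr_alg_hom B C) (l : gr_alg_hom A C),
    l =1 k \o h -> af_map l =1 af_map k \o af_map h
}.

Record mod_functor (ungraded : bool) (G : zmodType) := ModFunctor {
  mf_obj :> ft_alg ungraded -> gr_mod G;
  mf_map : forall A B : ft_alg ungraded,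
    gr_alg_hom A B -> gr_mod_hom (mf_obj A) (mf_obj B);
  mf_id : forall (A : ft_alg ungraded) (h : gr_alg_hom A A),
    h =1 id -> mf_map h =1 id;
  mf_comp : forall (A B C : ft_alg ungraded) (h : gr_alg_hom A B)
      (k : gr_alg_hom B C) (l : gr_alg_hom A C),
    l =1 k \o h -> mf_map l =1 mf_map k \o mf_map h
}.

Inductive term (X : Type) :=
  | TGen of X
  | TZero
  | TOne
  | TAdd of term X & term X
  | TMul of term X & term X.
Arguments TZero {X}.
Arguments TOne {X}.

HB.instance Definition _ (X : Type) := gen_eqMixin (term X).
HB.instance Definition _ (X : Type) := gen_choiceMixin (term X).

Declare Scope term_scope.
Delimit Scope term_scope with T.
Bind Scope term_scope with term.
Notation "0" := TZero : term_scope.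
Notation "1" := TOne : term_scope.
Notation "x + y" := (TAdd x y) : term_scope.
Notation "x * y" := (TMul x y) : term_scope.

Section PresentedAlgebra.
Variables (X : Type) (R : term X -> term X -> Prop).

Inductive term_cong : term X -> term X -> Prop :=
  | cong_rel s t of R s t : term_cong s t
  | cong_refl t : term_cong t t
  | cong_sym s t of term_cong s t : term_cong t s
  | cong_trans s t r of term_cong s t & term_cong t r : term_cong s r
  | cong_add s s' t t' of term_cong s s' & term_cong t t' :
      term_cong (s + t) (s' + t')
  | cong_mul s s' t t' of term_cong s s' & term_cong t t' :
      term_cong (s * t) (s' * t')
  | cong_addA s t r : term_cong (s + (t + r)) (s + t + r)
  | cong_addC s t : term_cong (s + t) (t + s)
  | cong_add0 t : term_cong (0 + t) t
  | cong_addtt t : term_cong (t + t) 0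
  | cong_mulA s t r : term_cong (s * (t * r)) (s * t * r)
  | cong_mulC s t : term_cong (s * t) (t * s)
  | cong_mul1 t : term_cong (1 * t) t
  | cong_mulD s t r : term_cong ((s + t) * r) (s * r + t * r).

Definition term_congb (s t : term X) : bool := `[< term_cong s t >].

Lemma term_congb_refl : reflexive term_congb.
Proof. by move=> t; apply/asboolP; constructor. Qed.

Lemma term_congb_sym : symmetric term_congb.
Proof. by move=> s t; apply/asboolP/asboolP; apply: cong_sym. Qed.

Lemma term_congb_trans : transitive term_congb.
Proof.
by move=> t s r /asboolP st /asboolP tr; apply/asboolP; apply: cong_trans tr.
Qed.

Canonical term_equiv :=
  EquivRel term_congb term_congb_refl term_congb_sym term_congb_trans.

Local Open Scope quotient_scope.

Definition presented := {eq_quot term_equiv}.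
HB.instance Definition _ := Choice.on presented.
HB.instance Definition _ := EqQuotient.on presented.

Definition pclass (t : term X) : presented := \pi t.

Lemma pclassP s t : pclass s = pclass t <-> term_cong s t.
Proof.
split=> [/eqP|st]; first by rewrite /pclass eqmodE => /asboolP.
by apply/eqP; rewrite /pclass eqmodE; apply/asboolP.
Qed.

Lemma pclass_repr (x : presented) : pclass (repr x) = x.
Proof. exact: reprK. Qed.

Lemma pclass_surj (x : presented) : exists t, x = pclass t.
Proof. by exists (repr x); rewrite pclass_repr. Qed.

Definition padd (x y : presented) := pclass (repr x + repr y)%T.
Definition pmul (x y : presented) := pclass (repr x * repr y)%T.

Lemma paddE s t : padd (pclass s) (pclass t) = pclass (s + t)%T.
Proof. by apply/pclassP; apply: cong_add; apply/pclassP; rewrite pclass_repr. Qed.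

Lemma pmulE s t : pmul (pclass s) (pclass t) = pclass (s * t)%T.
Proof. by apply/pclassP; apply: cong_mul; apply/pclassP; rewrite pclass_repr. Qed.

Lemma paddA : associative padd.
Proof.
move=> x y z; have [r ->] := pclass_surj x; have [s ->] := pclass_surj y.
by have [t ->] := pclass_surj z; rewrite !paddE; apply/pclassP; constructor.
Qed.

Lemma paddC : commutative padd.
Proof.
move=> x y; have [r ->] := pclass_surj x; have [s ->] := pclass_surj y.
by rewrite !paddE; apply/pclassP; constructor.
Qed.

Lemma padd0 : left_id (pclass 0%T) padd.
Proof.
by move=> x; have [r ->] := pclass_surj x; rewrite paddE; apply/pclassP; constructor.
Qed.

Lemma paddN : left_inverse (pclass 0%T) id padd.
Proof.
by move=> x; have [r ->] := pclass_surj x; rewrite paddE; apply/pclassP; constructor.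
Qed.

Lemma pmulA : associative pmul.
Proof.
move=> x y z; have [r ->] := pclass_surj x; have [s ->] := pclass_surj y.
by have [t ->] := pclass_surj z; rewrite !pmulE; apply/pclassP; constructor.
Qed.

Lemma pmulC : commutative pmul.
Proof.
move=> x y; have [r ->] := pclass_surj x; have [s ->] := pclass_surj y.
by rewrite !pmulE; apply/pclassP; constructor.
Qed.

Lemma pmul1 : left_id (pclass 1%T) pmul.
Proof.
by move=> x; have [r ->] := pclass_surj x; rewrite pmulE; apply/pclassP; constructor.
Qed.

Lemma pmulD : left_distributive pmul padd.
Proof.
move=> x y z; have [r ->] := pclass_surj x; have [s ->] := pclass_surj y.
have [t ->] := pclass_surj z; rewrite !(paddE, pmulE).
by apply/pclassP; constructor.
Qed.

HB.instance Definition _ := GRing.isZmodule.Build presented paddA paddC padd0 paddN.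
HB.instance Definition _ :=
  GRing.Zmodule_isComPzRing.Build presented pmulA pmulC pmul1 pmulD.

Definition pgen (x : X) : presented := pclass (TGen x).

Lemma poppE (x : presented) : - x = x.
Proof. by []. Qed.

Lemma pclassD s t : pclass (s + t)%T = pclass s + pclass t.
Proof. by rewrite -paddE. Qed.

Lemma pclassM s t : pclass (s * t)%T = pclass s * pclass t.
Proof. by rewrite -pmulE. Qed.

Inductive pterm_hom (I : nmodType) (gdeg : X -> I -> Prop) :
    I -> presented -> Prop :=
  | phom_gen x d of gdeg x d : pterm_hom gdeg d (pgen x)
  | phom_zero d : pterm_hom gdeg d 0
  | phom_one : pterm_hom gdeg 0 1
  | phom_add d x y of pterm_hom gdeg d x & pterm_hom gdeg d y :
      pterm_hom gdeg d (x + y)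
  | phom_mul d d' x y of pterm_hom gdeg d x & pterm_hom gdeg d' y :
      pterm_hom gdeg (d + d') (x * y).

End PresentedAlgebra.

Fixpoint term_map (X Y : Type) (f : X -> Y) (t : term X) : term Y :=
  match t with
  | TGen x => TGen (f x)
  | TZero => TZero
  | TOne => TOne
  | TAdd s t => TAdd (term_map f s) (term_map f t)
  | TMul s t => TMul (term_map f s) (term_map f t)
  end.

(* The map of presented algebras induced by a map f of generators; it is
   meaningful when f sends relations to relations, see presented_mapE. *)
Definition presented_map (X Y : Type) (R : term X -> term X -> Prop)
    (S : term Y -> term Y -> Prop) (f : X -> Y) (x : presented R) : presented S :=
  pclass S (term_map f (repr x)).

Section PresentedMap.
Variables (X Y : Type) (R : term X -> term X -> Prop) (S : term Y -> term Y -> Prop).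
Variable f : X -> Y.
Hypothesis fRS : forall s t, R s t -> S (term_map f s) (term_map f t).

Lemma term_map_cong s t :
  term_cong R s t -> term_cong S (term_map f s) (term_map f t).
Proof.
elim=> {s t} /=.
- by move=> s t /fRS; apply: cong_rel.
- by move=> t; apply: cong_refl.
- by move=> s t _; apply: cong_sym.
- by move=> s t r _ st _ tr; apply: cong_trans tr.
- by move=> s s' t t' _ ss' _ tt'; apply: cong_add.
- by move=> s s' t t' _ ss' _ tt'; apply: cong_mul.
- by move=> s t r; apply: cong_addA.
- by move=> s t; apply: cong_addC.
- by move=> t; apply: cong_add0.
- by move=> t; apply: cong_addtt.
- by move=> s t r; apply: cong_mulA.
- by move=> s t; apply: cong_mulC.
- by move=> t; apply: cong_mul1.
- by move=> s t r; apply: cong_mulD.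
Qed.

Lemma presented_mapE t :
  presented_map S f (pclass R t) = pclass S (term_map f t).
Proof. by apply/pclassP/term_map_cong/pclassP; rewrite pclass_repr. Qed.

End PresentedMap.

Section PresentedModule.
Variable L : comPzRingType.

Inductive mterm (X : Type) :=
  | MGen of X
  | MZero
  | MAdd of mterm X & mterm X
  | MScale of L & mterm X.
Arguments MZero {X}.

HB.instance Definition _ (X : Type) := gen_eqMixin (mterm X).
HB.instance Definition _ (X : Type) := gen_choiceMixin (mterm X).

Variables (X : Type) (R : mterm X -> mterm X -> Prop).

Inductive mterm_cong : mterm X -> mterm X -> Prop :=
  | mcong_rel s t of R s t : mterm_cong s t
  | mcong_refl t : mterm_cong t t
  | mcong_sym s t of mterm_cong s t : mterm_cong t s
  | mcong_trans s t r of mterm_cong s t & mterm_cong t r : mterm_cong s r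
  | mcong_add s s' t t' of mterm_cong s s' & mterm_cong t t' :
      mterm_cong (MAdd s t) (MAdd s' t')
  | mcong_scale a t t' of mterm_cong t t' : mterm_cong (MScale a t) (MScale a t')
  | mcong_addA s t r : mterm_cong (MAdd s (MAdd t r)) (MAdd (MAdd s t) r)
  | mcong_addC s t : mterm_cong (MAdd s t) (MAdd t s)
  | mcong_add0 t : mterm_cong (MAdd MZero t) t
  | mcong_addN t : mterm_cong (MAdd (MScale (-1) t) t) MZero
  | mcong_scaleA a b t : mterm_cong (MScale a (MScale b t)) (MScale (a * b) t)
  | mcong_scale1 t : mterm_cong (MScale 1 t) t
  | mcong_scaleDr a s t :
      mterm_cong (MScale a (MAdd s t)) (MAdd (MScale a s) (MScale a t))
  | mcong_scaleDl a b t :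
      mterm_cong (MScale (a + b) t) (MAdd (MScale a t) (MScale b t)).

Definition mterm_congb (s t : mterm X) : bool := `[< mterm_cong s t >].

Lemma mterm_congb_refl : reflexive mterm_congb.
Proof. by move=> t; apply/asboolP; constructor. Qed.

Lemma mterm_congb_sym : symmetric mterm_congb.
Proof. by move=> s t; apply/asboolP/asboolP; apply: mcong_sym. Qed.

Lemma mterm_congb_trans : transitive mterm_congb.
Proof.
by move=> t s r /asboolP st /asboolP tr; apply/asboolP; apply: mcong_trans tr.
Qed.

Canonical mterm_equiv :=
  EquivRel mterm_congb mterm_congb_refl mterm_congb_sym mterm_congb_trans.

Local Open Scope quotient_scope.

Definition presented_mod := {eq_quot mterm_equiv}.
HB.instance Definition _ := Choice.on presented_mod.
HB.instance Definition _ := EqQuotient.on presented_mod.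

Definition mclass (t : mterm X) : presented_mod := \pi t.

Lemma mclassP s t : mclass s = mclass t <-> mterm_cong s t.
Proof.
split=> [/eqP|st]; first by rewrite /mclass eqmodE => /asboolP.
by apply/eqP; rewrite /mclass eqmodE; apply/asboolP.
Qed.

Lemma mclass_repr (x : presented_mod) : mclass (repr x) = x.
Proof. exact: reprK. Qed.

Lemma mclass_surj (x : presented_mod) : exists t, x = mclass t.
Proof. by exists (repr x); rewrite mclass_repr. Qed.

Definition madd (x y : presented_mod) := mclass (MAdd (repr x) (repr y)).
Definition mscale (a : L) (x : presented_mod) := mclass (MScale a (repr x)).
Definition mopp (x : presented_mod) := mscale (-1) x.

Lemma maddE s t : madd (mclass s) (mclass t) = mclass (MAdd s t).
Proof. by apply/mclassP; apply: mcong_add; apply/mclassP; rewrite mclass_repr. Qed.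

Lemma mscaleE a t : mscale a (mclass t) = mclass (MScale a t).
Proof. by apply/mclassP; apply: mcong_scale; apply/mclassP; rewrite mclass_repr. Qed.

Lemma maddA : associative madd.
Proof.
move=> x y z; have [r ->] := mclass_surj x; have [s ->] := mclass_surj y.
by have [t ->] := mclass_surj z; rewrite !maddE; apply/mclassP; constructor.
Qed.

Lemma maddC : commutative madd.
Proof.
move=> x y; have [r ->] := mclass_surj x; have [s ->] := mclass_surj y.
by rewrite !maddE; apply/mclassP; constructor.
Qed.

Lemma madd0 : left_id (mclass MZero) madd.
Proof.
by move=> x; have [r ->] := mclass_surj x; rewrite maddE; apply/mclassP; constructor.
Qed.

Lemma maddN : left_inverse (mclass MZero) mopp madd.
Proof.
move=> x; have [r ->] := mclass_surj x.
by rewrite /mopp mscaleE maddE; apply/mclassP; constructor.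
Qed.

HB.instance Definition _ :=
  GRing.isZmodule.Build presented_mod maddA maddC madd0 maddN.

Lemma mscaleA a b x : mscale a (mscale b x) = mscale (a * b) x.
Proof.
by have [r ->] := mclass_surj x; rewrite !mscaleE; apply/mclassP; constructor.
Qed.

Lemma mscale1 : left_id 1 mscale.
Proof.
by move=> x; have [r ->] := mclass_surj x; rewrite mscaleE; apply/mclassP; constructor.
Qed.

Lemma mscaleDr : right_distributive mscale +%R.
Proof.
move=> a x y; have [r ->] := mclass_surj x; have [s ->] := mclass_surj y.
rewrite -[mclass r + mclass s]/(madd _ _) -[RHS]/(madd _ _).
by rewrite !(maddE, mscaleE); apply/mclassP; constructor.
Qed.

Lemma mscaleDl x : {morph mscale^~ x : a b / a + b}.
Proof.
move=> a b; have [r ->] := mclass_surj x.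
by rewrite -[RHS]/(madd _ _) !(maddE, mscaleE); apply/mclassP; constructor.
Qed.

HB.instance Definition _ := GRing.Zmodule_isLmodule.Build L presented_mod
  mscaleA mscale1 mscaleDr mscaleDl.

Definition mgen (x : X) : presented_mod := mclass (MGen x).

Lemma mclassD s t : mclass (MAdd s t) = mclass s + mclass t.
Proof. by rewrite -maddE. Qed.

Lemma mclassZ a t : mclass (MScale a t) = a *: mclass t.
Proof. by rewrite -mscaleE. Qed.

Inductive mterm_hom (I : nmodType) (sdeg : I -> L -> Prop)
    (gdeg : X -> I -> Prop) : I -> presented_mod -> Prop :=
  | mhom_gen x d of gdeg x d : mterm_hom sdeg gdeg d (mgen x)
  | mhom_zero d : mterm_hom sdeg gdeg d 0
  | mhom_add d x y of mterm_hom sdeg gdeg d x & mterm_hom sdeg gdeg d y :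
      mterm_hom sdeg gdeg d (x + y)
  | mhom_scale d d' a x of sdeg d a & mterm_hom sdeg gdeg d' x :
      mterm_hom sdeg gdeg (d + d') (a *: x).

End PresentedModule.
Arguments MGen {L X}.
Arguments MZero {L X}.
Arguments MAdd {L X}.
Arguments MScale {L X}.

Fixpoint mterm_map (L M : comPzRingType) (X Y : Type) (g : L -> M) (f : X -> Y)
    (t : mterm L X) : mterm M Y :=
  match t with
  | MGen x => MGen (f x)
  | MZero => MZero
  | MAdd s t => MAdd (mterm_map g f s) (mterm_map g f t)
  | MScale a t => MScale (g a) (mterm_map g f t)
  end.

Definition presented_mod_map (L M : comPzRingType) (X Y : Type)
    (R : mterm L X -> mterm L X -> Prop) (S : mterm M Y -> mterm M Y -> Prop)
    (g : L -> M) (f : X -> Y) (x : presented_mod R) : presented_mod S :=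
  mclass S (mterm_map g f (repr x)).

Section PresentedModMap.
Variables (L M : comPzRingType) (X Y : Type).
Variables (R : mterm L X -> mterm L X -> Prop) (S : mterm M Y -> mterm M Y -> Prop).
Variables (g : {rmorphism L -> M}) (f : X -> Y).
Hypothesis fRS : forall s t, R s t -> S (mterm_map g f s) (mterm_map g f t).

Lemma mterm_map_cong s t :
  mterm_cong R s t -> mterm_cong S (mterm_map g f s) (mterm_map g f t).
Proof.
elim=> {s t} /=.
- by move=> s t /fRS; apply: mcong_rel.
- by move=> t; apply: mcong_refl.
- by move=> s t _; apply: mcong_sym.
- by move=> s t r _ st _ tr; apply: mcong_trans tr.
- by move=> s s' t t' _ ss' _ tt'; apply: mcong_add.
- by move=> a t t' _ tt'; apply: mcong_scale.
- by move=> s t r; apply: mcong_addA.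
- by move=> s t; apply: mcong_addC.
- by move=> t; apply: mcong_add0.
- by move=> t; rewrite rmorphN1; apply: mcong_addN.
- by move=> a b t; rewrite rmorphM; apply: mcong_scaleA.
- by move=> t; rewrite rmorph1; apply: mcong_scale1.
- by move=> a s t; apply: mcong_scaleDr.
- by move=> a b t; rewrite rmorphD; apply: mcong_scaleDl.
Qed.

Lemma presented_mod_mapE t :
  presented_mod_map S g f (mclass R t) = mclass S (mterm_map g f t).
Proof. by apply/mclassP/mterm_map_cong/mclassP; rewrite mclass_repr. Qed.

End PresentedModMap.

Inductive ell_gen (A : Type) := Delta of A | Phi of A | Qop of A | Uop.
Arguments Uop {A}.

Section EllRelations.
Variable A : comPzRingType.
Local Notation d a := (TGen (Delta a)).
Local Notation phi a := (TGen (Phi a)).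
Local Notation q a := (TGen (Qop a)).
Local Notation u := (TGen Uop).

Inductive ell_rel : term (ell_gen A) -> term (ell_gen A) -> Prop :=
  | ell_phiD a b : ell_rel (phi (a + b)%R) (phi a + phi b)
  | ell_deltaD a b : ell_rel (d (a + b)%R) (d a + d b)
  | ell_qD a b : ell_rel (q (a + b)%R) (q a + q b + d (a * b)%R)
  | ell_delta3 a b c :
      ell_rel (d (a * b)%R * d c + d (b * c)%R * d a + d (c * a)%R * d b) 0
  | ell_phiM a b : ell_rel (phi (a * b)%R) (phi a * phi b + u * q a * q b)
  | ell_qM a b : ell_rel (q (a * b)%R) (q a * phi b + phi a * q b)
  | ell_delta_sq a : ell_rel (d a * d a) 0
  | ell_q_sq a : ell_rel (q a * q a) 0
  | ell_delta_phi a b : ell_rel (d a * phi b) (d (a * b ^+ 2)%R)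
  | ell_delta_q a b : ell_rel (d a * q b) (d (a * b)%R * d b)
  | ell_u_delta a : ell_rel (u * d a) 0
  | ell_phi1 : ell_rel (phi 1%R) 1.

End EllRelations.

Inductive per_gen (A : Type) := PPhi of A | PQop of A | PUop | PUinv.
Arguments PUop {A}.
Arguments PUinv {A}.

Section PerRelations.
Variable A : comPzRingType.
Local Notation phi a := (TGen (PPhi a)).
Local Notation q a := (TGen (PQop a)).
Local Notation u := (TGen PUop).
Local Notation v := (TGen PUinv).

Inductive per_rel : term (per_gen A) -> term (per_gen A) -> Prop :=
  | per_phiD a b : per_rel (phi (a + b)%R) (phi a + phi b)
  | per_qD a b : per_rel (q (a + b)%R) (q a + q b)
  | per_phiM a b : per_rel (phi (a * b)%R) (phi a * phi b + u * q a * q b)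
  | per_qM a b : per_rel (q (a * b)%R) (q a * phi b + phi a * q b)
  | per_q_sq a : per_rel (q a * q a) 0
  | per_uv : per_rel (u * v) 1
  | per_phi1 : per_rel (phi 1%R) 1.

End PerRelations.

Definition ell (A : comPzRingType) := presented (@ell_rel A).
HB.instance Definition _ A := GRing.ComPzRing.on (ell A).
Definition ell_per (A : comPzRingType) := presented (@per_rel A).
HB.instance Definition _ A := GRing.ComPzRing.on (ell_per A).

Definition ell_delta (A : comPzRingType) (a : A) : ell A := pgen _ (Delta a).
Definition ell_phi (A : comPzRingType) (a : A) : ell A := pgen _ (Phi a).
Definition ell_q (A : comPzRingType) (a : A) : ell A := pgen _ (Qop a).
Definition ell_u (A : comPzRingType) : ell A := pgen _ Uop.
Definition per_phi (A : comPzRingType) (a : A) : ell_per A := pgen _ (PPhi a).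
Definition per_q (A : comPzRingType) (a : A) : ell_per A := pgen _ (PQop a).
Definition per_u (A : comPzRingType) : ell_per A := pgen _ PUop.
Definition per_uinv (A : comPzRingType) : ell_per A := pgen _ PUinv.

Inductive plus_gen (A : Type) := Gamma of A | Vop of nat.
Arguments Vop {A}.

Section PlusRelations.
Variable A : comPzRingType.
Local Notation gamma a := (MGen (Gamma a)).
Local Notation v i := (MGen (Vop i)).
Local Notation "x +m y" := (MAdd x y) (at level 50, left associativity).
Local Notation "a *m x" := (MScale a x) (at level 40, left associativity).

Inductive plus_rel :
    mterm (ell A) (plus_gen A) -> mterm (ell A) (plus_gen A) -> Prop :=
  | plus_gammaD a b : plus_rel (gamma (a + b)) (gamma a +m gamma b)
  | plus_phi a b : plus_rel (ell_phi a *m gamma b) (gamma (a ^+ 2 * b))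
  | plus_q a b : plus_rel (ell_q a *m gamma b) (ell_delta a *m gamma (a * b))
  | plus_delta a b : plus_rel (ell_delta a *m gamma b) (ell_delta b *m gamma a)
  | plus_delta3 a b c :
      plus_rel (ell_delta (b * c) *m gamma a +m ell_delta c *m gamma (a * b)
                +m ell_delta b *m gamma (a * c)) MZero
  | plus_u_gamma a : plus_rel (ell_u A *m gamma a) MZero
  | plus_delta_v a i : plus_rel (ell_delta a *m v i) MZero
  | plus_u_v i : plus_rel (ell_u A *m v i.+1) (v i)
  | plus_gamma1 : plus_rel (gamma 1) (v 0%N).

End PlusRelations.

Definition ell_plus (A : comPzRingType) := presented_mod (@plus_rel A).
HB.instance Definition _ A := GRing.Lmodule.on (ell_plus A).
Definition plus_gamma (A : comPzRingType) (a : A) : ell_plus A := mgen _ (Gamma a).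
Definition plus_v (A : comPzRingType) (i : nat) : ell_plus A := mgen _ (Vop i).

Definition ell_gen_map (A B : Type) (h : A -> B) (x : ell_gen A) : ell_gen B :=
  match x with
  | Delta a => Delta (h a)
  | Phi a => Phi (h a)
  | Qop a => Qop (h a)
  | Uop => Uop
  end.

Definition per_gen_map (A B : Type) (h : A -> B) (x : per_gen A) : per_gen B :=
  match x with
  | PPhi a => PPhi (h a)
  | PQop a => PQop (h a)
  | PUop => PUop
  | PUinv => PUinv
  end.

Definition plus_gen_map (A B : Type) (h : A -> B) (x : plus_gen A) : plus_gen B :=
  match x with
  | Gamma a => Gamma (h a)
  | Vop i => Vop i
  end.

Section EllFunctoriality.
Variables (A B : comPzRingType) (h : {rmorphism A -> B}).

Definition ell_map : ell A -> ell B := presented_map (@ell_rel B) (ell_gen_map h).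
Definition per_map : ell_per A -> ell_per B :=
  presented_map (@per_rel B) (per_gen_map h).
Definition plus_map : ell_plus A -> ell_plus B :=
  presented_mod_map (@plus_rel B) ell_map (plus_gen_map h).

Lemma ell_rel_map s t : ell_rel s t ->
  ell_rel (term_map (ell_gen_map h) s) (term_map (ell_gen_map h) t).
Proof.
by case=> *; rewrite /= ?(rmorphD, rmorphM, rmorphXn, rmorph1); constructor.
Qed.

Lemma per_rel_map s t : per_rel s t ->
  per_rel (term_map (per_gen_map h) s) (term_map (per_gen_map h) t).
Proof. by case=> *; rewrite /= ?(rmorphD, rmorphM, rmorph1); constructor. Qed.

Lemma ell_mapE t : ell_map (pclass _ t) = pclass _ (term_map (ell_gen_map h) t).
Proof. exact: presented_mapE ell_rel_map t. Qed.

Lemma per_mapE t : per_map (pclass _ t) = pclass _ (term_map (per_gen_map h) t).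
Proof. exact: presented_mapE per_rel_map t. Qed.

Lemma ell_map_zmod_morphism : zmod_morphism ell_map.
Proof.
move=> x y; have [s ->] := pclass_surj x; have [t ->] := pclass_surj y.
rewrite [in LHS]poppE [in RHS]poppE -pclassD !ell_mapE.
exact: pclassD.
Qed.

Lemma ell_map_monoid_morphism : monoid_morphism ell_map.
Proof.
split=> [|x y]; first exact: ell_mapE 1%T.
have [s ->] := pclass_surj x; have [t ->] := pclass_surj y.
by rewrite -pclassM !ell_mapE -pclassM.
Qed.

HB.instance Definition _ :=
  GRing.isZmodMorphism.Build (ell A) (ell B) ell_map ell_map_zmod_morphism.
HB.instance Definition _ :=
  GRing.isMonoidMorphism.Build (ell A) (ell B) ell_map ell_map_monoid_morphism.

Lemma plus_rel_map s t : plus_rel s t ->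
  plus_rel (mterm_map ell_map (plus_gen_map h) s)
           (mterm_map ell_map (plus_gen_map h) t).
Proof.
have Ed a : ell_map (ell_delta a) = ell_delta (h a) by exact: ell_mapE.
have Ep a : ell_map (ell_phi a) = ell_phi (h a) by exact: ell_mapE.
have Eq a : ell_map (ell_q a) = ell_q (h a) by exact: ell_mapE.
have Eu : ell_map (ell_u A) = ell_u B by exact: ell_mapE.
case=> *; rewrite /= ?(Ed, Ep, Eq, Eu) ?(rmorphD, rmorphM, rmorphXn, rmorph1);
  by constructor.
Qed.

Lemma plus_mapE t : plus_map (mclass _ t) =
  mclass _ (mterm_map ell_map (plus_gen_map h) t).
Proof. exact: presented_mod_mapE plus_rel_map t. Qed.

End EllFunctoriality.

Section EllDegrees.
Variable A : gr_alg nat.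

(* Degrees are pairs (homological degree, upper degree). *)
Inductive ell_gen_deg : ell_gen A -> int * int -> Prop :=
  | deg_delta s a of ga_piece s a : ell_gen_deg (Delta a) (1, s%:Z - 1)
  | deg_phi s a of ga_piece s a : ell_gen_deg (Phi a) (0, s%:Z *+ 2)
  | deg_q s a of ga_piece s a : ell_gen_deg (Qop a) (1, s%:Z *+ 2 - 1)
  | deg_u : ell_gen_deg Uop (- 2, 2).

Inductive per_gen_deg : per_gen A -> int * int -> Prop :=
  | deg_pphi s a of ga_piece s a : per_gen_deg (PPhi a) (0, s%:Z *+ 2)
  | deg_pq s a of ga_piece s a : per_gen_deg (PQop a) (1, s%:Z *+ 2 - 1)
  | deg_pu : per_gen_deg PUop (- 2, 2)
  | deg_puinv : per_gen_deg PUinv (2, - 2).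

Inductive plus_gen_deg : plus_gen A -> int * int -> Prop :=
  | deg_gamma s a of ga_piece s a : plus_gen_deg (Gamma a) (0, s%:Z)
  | deg_v i : plus_gen_deg (Vop i) (i%:Z *+ 2, - (i%:Z *+ 2)).

Definition ell_piece : int * int -> ell A -> Prop := pterm_hom ell_gen_deg.
Definition per_piece : int * int -> ell_per A -> Prop := pterm_hom per_gen_deg.
Definition plus_piece : int * int -> ell_plus A -> Prop :=
  mterm_hom ell_piece plus_gen_deg.

End EllDegrees.

(* A word (a_0, [:: a_1; ...; a_n]) stands for a_0[a_1|...|a_n]. *)
Notation word A := (A * seq A)%type.
Notation formal A := {malg 'F_2[word A]}.

Definition lin_ext (K : choiceType) (V : lmodType 'F_2) (f : K -> V)
    (x : {malg 'F_2[K]}) : V :=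
  \sum_(k <- msupp x) x@_k *: f k.

Definition bilin_ext (K L : choiceType) (V : lmodType 'F_2) (f : K -> L -> V)
    (x : {malg 'F_2[K]}) (y : {malg 'F_2[L]}) : V :=
  lin_ext (fun k => lin_ext (f k) y) x.

Section Chains.
Variable A : comPzRingType.
Implicit Types (w : word A) (s : seq A).

(* The kernel of the projection from formal sums of words onto the direct sum of
   the C_n(A); all operations below are defined on formal sums, and equalities of
   chains are taken modulo [null]. *)
Inductive null : formal A -> Prop :=
  | null_zero : null 0
  | null_sub x y of null x & null y : null (x - y)
  | null_head a b s :
      null (<< (a + b, s) : word A >> - << (a, s) : word A >> - << (b, s) : word A >>)
  | null_tail a s a1 a2 s' :
      null (<< (a, s ++ (a1 + a2)%R :: s') : word A >>
            - << (a, s ++ a1 :: s') : word A >> - << (a, s ++ a2 :: s') : word A >>)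
  | null_unit a s s' : null << (a, s ++ 1%R :: s') : word A >>.

Definition hoch_b_word w : formal A :=
  let: (a, s) := w in
  if s is a1 :: s' then
    << (a * a1, s') : word A >>
    + \sum_(i < (size s).-1)
        << (a, take i s ++ (s`_i * s`_i.+1)%R :: drop i.+2 s) : word A >>
    + << (last a1 s' * a, take (size s).-1 s) : word A >>
  else 0.

Definition connes_B_word w : formal A :=
  \sum_(i < (size w.2).+1) << (1, rot i (w.1 :: w.2)) : word A >>.

Definition hoch_b : formal A -> formal A := lin_ext hoch_b_word.
Definition connes_B : formal A -> formal A := lin_ext connes_B_word.

(* sigma . [a_1|...|a_n] = [a_(sigma^-1 1)|...|a_(sigma^-1 n)] *)
Definition perm_act n (sigma : 'S_n) s : seq A :=
  [seq s`_((sigma^-1)%g i) | i <- enum 'I_n].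

Definition is_shuffle p q (sigma : 'S_(p + q)) : bool :=
  [forall i : 'I_(p + q), forall j : 'I_(p + q),
    (i < j)%N && ((j < p)%N || (p <= i)%N) ==> (sigma i < sigma j)%N].

(* Indices start at 0, so the sequence (sigma(1), ..., sigma(p+q)) is a shuffle of
   cyclic permutations of (0, ..., p-1) and (p, ..., p+q-1). *)
Definition is_cyclic_shuffle p q (sigma : 'S_(p + q)) : bool :=
  let l := [seq val (sigma i) | i <- enum 'I_(p + q)] in
  [&& [exists i : 'I_p, [seq x <- l | (x < p)%N] == rot i (iota 0 p)],
      [exists j : 'I_q, [seq x <- l | (p <= x)%N] == rot j (iota p q)]
    & (index 0%N l < index p l)%N].

Definition shuffle_word w w' : formal A :=
  \sum_(sigma : 'S_(size w.2 + size w'.2) | is_shuffle sigma)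
    << (w.1 * w'.1, perm_act sigma (w.2 ++ w'.2)) : word A >>.

Definition cyclic_shuffle_word w w' : formal A :=
  \sum_(sigma : 'S_((size w.2).+1 + (size w'.2).+1) | is_cyclic_shuffle sigma)
    << (1, perm_act (sigma^-1)%g ((w.1 :: w.2) ++ (w'.1 :: w'.2))) : word A >>.

Definition shuffle_prod : formal A -> formal A -> formal A :=
  bilin_ext shuffle_word.
Definition cyclic_shuffle_prod : formal A -> formal A -> formal A :=
  bilin_ext cyclic_shuffle_word.

End Chains.

Inductive theory := Neg | Per | Pos.

Definition u_range (v : theory) (i : int) : bool :=
  match v with Neg => 0 <= i | Per => true | Pos => i <= 0 end.

(* A cyclic chain c stands for the formal sum of the u^i (x) c i. *)
Notation cchain A := (int -> formal A).

Section CyclicChains.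
Variables (A : gr_alg nat) (v : theory).
Implicit Types (c : cchain A) (d : int * int).

Definition cyc_single (i : int) (w : word A) : cchain A :=
  fun j => if j == i then << w >> else 0.

Definition hom_word (s : int) (w : word A) : Prop :=
  exists s0 (r : seq nat),
    [/\ ga_piece s0 w.1, List.Forall2 (@ga_piece _ A) r w.2
      & (s0 + sumn r)%N%:Z = s].

(* Membership in (C^v_n)^m, for d = (n, m): c i lies in C_(n+2i)(A) and has upper
   degree m - 2i, that is, internal degree m + n. For fixed d no finiteness in i is
   imposed, which gives the products defining C^- and C^per; for C^+ finiteness is
   automatic as i <= 0 and n + 2i >= 0. *)
Definition cyc_hom d c : Prop := forall i,
  if u_range v i then
    (forall w, w \in msupp (c i) -> (size w.2)%:Z = d.1 + i *+ 2) /\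
    (exists y : formal A, (forall w, w \in msupp y -> hom_word (d.1 + d.2) w) /\
       null (c i - y))
  else c i = 0.

(* The finite sums of elements of the (C^v_n)^m with (n, m) in P. *)
Inductive cyc_sum (P : int * int -> Prop) : cchain A -> Prop :=
  | cyc_sum0 : cyc_sum P 0
  | cyc_sumD d c c' of P d & cyc_hom d c & cyc_sum P c' : cyc_sum P (c + c').

Definition cyc_total : cchain A -> Prop := cyc_sum (fun=> True).

Definition cyc_diff c : cchain A := fun i =>
  if u_range v i then hoch_b (c i) + connes_B (c (i - 1)) else 0.

Definition cyc_null c : Prop := forall i, null (c i).

Definition is_cycle c : Prop := cyc_total c /\ cyc_null (cyc_diff c).
Definition is_boundary c : Prop :=
  exists e, cyc_total e /\ cyc_null (c - cyc_diff e).

End CyclicChains.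

(* The product of chains, with values in the complex of the theory v (where powers
   of u out of range are zero); the sum is finite for chains in cyc_total. *)
Definition cyc_mul (v : theory) (A : comPzRingType) (c c' : cchain A) : cchain A :=
  fun k => if u_range v k then
    \sum_(i \in [set: int]) (shuffle_prod (c i) (c' (k - i))
                             + cyclic_shuffle_prod (c i) (c' (k - 1 - i)))
  else 0.

Section LinExt.
Variables (K : choiceType) (V : lmodType 'F_2).
Implicit Types (f : K -> V) (x y : {malg 'F_2[K]}).

Lemma lin_extEw f (D : {fset K}) x : (msupp x `<=` D)%fset ->
  lin_ext f x = \sum_(k <- D) x@_k *: f k.
Proof.
move=> le; rewrite [LHS](big_fset_incl _ le) => //= k _ /mcoeff_outdom ->.
by rewrite scale0r.
Qed.

Lemma lin_ext_is_zmod_morphism f : zmod_morphism (lin_ext f).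
Proof.
move=> x y; rewrite (@lin_extEw _ (msupp x `|` msupp y)%fset) ?msuppB_le //.
rewrite (@lin_extEw _ (msupp x `|` msupp y)%fset x) ?fsubsetUl //.
rewrite (@lin_extEw _ (msupp x `|` msupp y)%fset y) ?fsubsetUr // -sumrB.
by apply: eq_bigr => k _; rewrite mcoeffB scalerBl.
Qed.

HB.instance Definition _ f :=
  GRing.isZmodMorphism.Build {malg 'F_2[K]} V (lin_ext f)
    (lin_ext_is_zmod_morphism f).

Lemma lin_extU f (k : K) : lin_ext f << k >> = f k.
Proof. by rewrite (lin_extEw _ msuppU_le) big_seq_fset1 mcoeffUU scale1r. Qed.

Lemma malg_F2E x : x = \sum_(k <- msupp x) << k >>.
Proof.
rewrite [LHS]monalgE; apply: eq_big_seq => k; rewrite -mcoeff_neq0.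
by case: (x@_k) => -[|[|//]] //= i _; congr << _ *g _ >>; apply: val_inj.
Qed.

Lemma additive_ext (W : zmodType) (f g : {additive {malg 'F_2[K]} -> W}) :
  (forall k, f << k >> = g << k >>) -> f =1 g.
Proof.
move=> fg x; rewrite [x]malg_F2E !raddf_sum.
by apply: eq_bigr => k _; rewrite fg.
Qed.

End LinExt.

Lemma hoch_bB (A : comPzRingType) (x y : formal A) :
  hoch_b (x - y) = hoch_b x - hoch_b y.
Proof. exact: lin_ext_is_zmod_morphism. Qed.

Lemma connes_BB (A : comPzRingType) (x y : formal A) :
  connes_B (x - y) = connes_B x - connes_B y.
Proof. exact: lin_ext_is_zmod_morphism. Qed.

Section ChainSubgroups.
Variables (A : gr_alg nat) (v : theory).
Implicit Types (c : cchain A) (d : int * int).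

Lemma nullN (x : formal A) : null x -> null (- x).
Proof. by move=> nx; rewrite -sub0r; apply: null_sub nx; apply: null_zero. Qed.

Lemma nullD (x y : formal A) : null x -> null y -> null (x + y).
Proof. by move=> nx /nullN ny; rewrite -[y]opprK; apply: null_sub. Qed.

Lemma cyc_homN d c : cyc_hom v d c -> cyc_hom v d (- c).
Proof.
move=> hc i; have := hc i; rewrite [(- c) i]/(- c i).
case: ifP => [_ [lc [y [hy cy]]] | _ ->]; last exact: oppr0.
split; first by move=> w; rewrite msuppN; apply: lc.
exists (- y); split; first by move=> w; rewrite msuppN; apply: hy.
by rewrite -opprD; apply: nullN.
Qed.

Lemma cyc_sumN P c : cyc_sum v P c -> cyc_sum v P (- c).
Proof.
elim=> [|d c1 c2 Pd /cyc_homN h1 _ h2]; first by rewrite oppr0; apply: cyc_sum0.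
by rewrite opprD; apply: cyc_sumD h1 h2.
Qed.

Lemma cyc_sum_add P c c' : cyc_sum v P c -> cyc_sum v P c' -> cyc_sum v P (c + c').
Proof.
move=> + hc'; elim=> [|d c1 c2 Pd h1 _ h2]; first by rewrite add0r.
by rewrite -addrA; apply: cyc_sumD h1 h2.
Qed.

Lemma cyc_subE c c' i : (c - c') i = c i - c' i.
Proof. by []. Qed.

Lemma cyc_diffB c c' : cyc_diff v (c - c') = cyc_diff v c - cyc_diff v c'.
Proof.
apply/funext => i; rewrite cyc_subE /cyc_diff !cyc_subE.
have [_ | _] := boolP (u_range v i); last by rewrite subr0.
by rewrite hoch_bB connes_BB opprD addrACA.
Qed.

Lemma is_cycle0 : is_cycle v (0 : cchain A).
Proof.
split=> [|i]; first exact: cyc_sum0.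
have := cyc_diffB 0 0; rewrite !subrr => ->; exact: null_zero.
Qed.

Lemma is_cycleB c c' : is_cycle v c -> is_cycle v c' -> is_cycle v (c - c').
Proof.
move=> [tc zc] [tc' zc']; split; first by apply: cyc_sum_add (cyc_sumN tc').
by rewrite cyc_diffB => i; apply: null_sub (zc i) (zc' i).
Qed.

Lemma is_boundary0 : is_boundary v (0 : cchain A).
Proof.
exists 0; split; first exact: cyc_sum0.
have := cyc_diffB 0 0; rewrite !subrr => ->; rewrite subr0 => i.
exact: null_zero.
Qed.

Lemma is_boundaryB c c' : is_boundary v c -> is_boundary v c' ->
  is_boundary v (c - c').
Proof.
move=> [e [te ce]] [e' [te' ce']]; exists (e - e').
split; first by apply: cyc_sum_add (cyc_sumN te').
suff -> : c - c' - cyc_diff v (e - e') =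
    c - cyc_diff v e - (c' - cyc_diff v e').
  by move=> i; apply: null_sub (ce i) (ce' i).
by rewrite cyc_diffB !opprD !opprK addrACA.
Qed.
End ChainSubgroups.

Section Homology.
Variables (A : gr_alg nat) (v : theory).

Definition cycle_pred : {pred cchain A} := fun c => `[< is_cycle v c >].

Lemma cycle_pred_zmod_closed : zmod_closed cycle_pred.
Proof.
split=> [|c c' /asboolP zc /asboolP zc']; first exact/asboolP/is_cycle0.
exact/asboolP/is_cycleB.
Qed.

HB.instance Definition _ :=
  GRing.isZmodClosed.Build (cchain A) cycle_pred cycle_pred_zmod_closed.

Record cycle_type := Cycle { cycle_val :> cchain A; _ : cycle_val \in cycle_pred }.
HB.instance Definition _ := [isSub for cycle_val].
HB.instance Definition _ := [Choice of cycle_type by <:].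
HB.instance Definition _ := [SubChoice_isSubZmodule of cycle_type by <:].

Definition boundary_pred : {pred cycle_type} := fun z => `[< is_boundary v z >].

Lemma boundary_pred_zmod_closed : zmod_closed boundary_pred.
Proof.
split=> [|z z' /asboolP bz /asboolP bz']; first exact/asboolP/is_boundary0.
exact/asboolP/is_boundaryB.
Qed.

HB.instance Definition _ :=
  GRing.isZmodClosed.Build cycle_type boundary_pred boundary_pred_zmod_closed.

(* HC v is HC^-_*(A), HC^per_*(A) or HC_*(A). *)
Definition HC := Quotient.quot boundary_pred.
HB.instance Definition _ := GRing.Zmodule.on HC.

Local Open Scope quotient_scope.

(* The homology class of a cycle (0 if c is not a cycle). *)
Definition hc_class (c : cchain A) : HC := \pi_HC (insubd (0 : cycle_type) c).

Definition represents (c : cchain A) (x : HC) : Prop :=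
  is_cycle v c /\ x = hc_class c.

Lemma cycle_valB (z z' : cycle_type) :
  cycle_val (z - z') = cycle_val z - cycle_val z'.
Proof. exact: (raddfB (val : cycle_type -> cchain A)). Qed.

Lemma hc_class_eq c c' : is_cycle v c -> is_cycle v c' ->
  hc_class c = hc_class c' <-> is_boundary v (c - c').
Proof.
move=> zc zc'.
have E : cycle_val (insubd (0 : cycle_type) c - insubd (0 : cycle_type) c') = c - c'.
  have V b : is_cycle v b -> cycle_val (insubd (0 : cycle_type) b) = b.
    by move=> zb; apply: insubdK; apply/asboolP.
  exact: etrans (cycle_valB _ _) (f_equal2 (fun a b => a - b) (V _ zc) (V _ zc')).
rewrite -E; split=> [/eqP | b].
  by rewrite /hc_class -Quotient.idealrBE => /asboolP.
by apply/eqP; rewrite /hc_class -Quotient.idealrBE; apply/asboolP.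
Qed.

Lemma represents_ex (x : HC) : exists c, represents c x.
Proof.
exists (cycle_val (repr x)); split.
  by case: (repr x) => c /= /asboolP.
by rewrite /hc_class valKd reprK.
Qed.

(* The part of HC of degree g, for the grading obtained from the bigrading by
   tdeg. *)
Definition hc_piece (G : zmodType) (tdeg : int * int -> G) (g : G) (x : HC) : Prop :=
  exists c, represents c x /\ cyc_sum v (fun d => tdeg d = g) c.

End Homology.

Definition word_map (A B : Type) (h : A -> B) (w : word A) : word B :=
  (h w.1, map h w.2).

Definition formal_map (A B : comPzRingType) (h : A -> B) : formal A -> formal B :=
  lin_ext (fun w => << word_map h w >>).

Definition cchain_map (A B : comPzRingType) (h : A -> B) (c : cchain A) : cchain B :=
  fun i => formal_map h (c i).

Definition hc_map (v : theory) (A B : gr_alg nat) (h : A -> B) (x : HC A v) : HC B v :=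
  hc_class v (cchain_map h (cycle_val (repr x))).

Section FormalMap.
Variables (A B : comPzRingType) (h : {rmorphism A -> B}).

Lemma formal_mapB x y : formal_map h (x - y) = formal_map h x - formal_map h y.
Proof. exact: lin_ext_is_zmod_morphism. Qed.

HB.instance Definition _ := GRing.isZmodMorphism.Build (formal A) (formal B)
  (formal_map h) formal_mapB.

Lemma formal_mapU (w : word A) : formal_map h << w >> = << word_map h w >>.
Proof. exact: lin_extU. Qed.

Lemma formal_map_null x : null x -> null (formal_map h x).
Proof.
elim=> [|{}x y _ nx _ ny|a b s|a s a1 a2 s'|a s s'].
- by rewrite raddf0; apply: null_zero.
- by rewrite formal_mapB; apply: null_sub.
- by rewrite 2!formal_mapB !formal_mapU /word_map /= rmorphD; apply: null_head.
- rewrite 2!formal_mapB !formal_mapU /word_map /= !map_cat /= rmorphD.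
  exact: null_tail.
- by rewrite formal_mapU /word_map /= map_cat /= rmorph1; apply: null_unit.
Qed.

Lemma nth_rmorph (s : seq A) i : (map h s)`_i = h s`_i.
Proof.
have [lt | le] := ltnP i (size s); first by rewrite (nth_map 0).
by rewrite !nth_default ?size_map ?rmorph0.
Qed.

Lemma hoch_b_map x : hoch_b (formal_map h x) = formal_map h (hoch_b x).
Proof.
rewrite [x]malg_F2E /hoch_b.
pose f := lin_ext (@hoch_b_word B) \o formal_map h.
pose g := formal_map h \o lin_ext (@hoch_b_word A).
suff: f =1 g by apply.
apply: additive_ext => w; rewrite /f /g /= formal_mapU !lin_extU.
case: w => a [|a1 s] /=; first by rewrite raddf0.
rewrite !raddfD raddf_sum /= !formal_mapU /word_map /= rmorphM size_map.
congr (_ + _ + _).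
- apply: eq_bigr => i _; rewrite formal_mapU /word_map /= map_cat map_cons.
  by rewrite map_take map_drop rmorphM -!nth_rmorph.
- by rewrite last_map rmorphM map_take.
Qed.

Lemma connes_B_map x : connes_B (formal_map h x) = formal_map h (connes_B x).
Proof.
pose f := lin_ext (@connes_B_word B) \o formal_map h.
pose g := formal_map h \o lin_ext (@connes_B_word A).
suff: f =1 g by apply.
apply: additive_ext => w; rewrite /f /g /= formal_mapU !lin_extU.
rewrite /connes_B_word raddf_sum /= size_map; apply: eq_bigr => i _.
by rewrite formal_mapU /word_map /= rmorph1 map_rot.
Qed.

Lemma msupp_formal_map x w : w \in msupp (formal_map h x) ->
  exists2 w', w' \in msupp x & w = word_map h w'.
Proof.
rewrite {1}[x]malg_F2E raddf_sum /= => wx; apply: contrapT => nw.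
have {wx} : (\sum_(k <- msupp x) formal_map h << k >>)@_w != 0.
  by rewrite mcoeff_neq0.
rewrite raddf_sum big1_seq ?eqxx //= => w' w'x.
rewrite formal_mapU mcoeffU; case: eqP => // e; case: nw.
by exists w'.
Qed.

End FormalMap.

Section HomologyMap.
Variables (v : theory) (A B : gr_alg nat) (h : gr_alg_hom A B).

Lemma hom_word_map s (w : word A) : hom_word s w -> hom_word s (word_map h w).
Proof.
move=> [s0 [r [p0 pr <-]]]; exists s0, r; split=> //; first exact: gah_piece.
rewrite /word_map /=; elim: pr => [|i a l1 l2 pa _ IH] /=; first exact: List.Forall2_nil.
by apply: List.Forall2_cons => //; apply: gah_piece.
Qed.

Lemma cyc_hom_map d (c : cchain A) : cyc_hom v d c -> cyc_hom v d (cchain_map h c).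
Proof.
move=> hc i; rewrite /cchain_map; have := hc i.
case: (u_range v i) => [[sz [y [hy ny]]] | ->]; last exact: raddf0.
split=> [w /msupp_formal_map[w' w'c ->]|].
  by rewrite /= size_map; apply: sz.
exists (formal_map h y); split=> [w /msupp_formal_map[w' w'y ->]|].
  exact/hom_word_map/hy.
by rewrite -formal_mapB; apply: formal_map_null.
Qed.

Lemma cchain_mapB (c c' : cchain A) :
  cchain_map h (c - c') = cchain_map h c - cchain_map h c'.
Proof. by apply/funext => i; apply: formal_mapB. Qed.

Lemma cchain_mapD (c c' : cchain A) :
  cchain_map h (c + c') = cchain_map h c + cchain_map h c'.
Proof. by apply/funext => i; apply: (raddfD (formal_map h)). Qed.

Lemma cyc_sum_map P (c : cchain A) : cyc_sum v P c -> cyc_sum v P (cchain_map h c).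
Proof.
elim=> [|d c1 c2 Pd h1 _ h2].
  have -> : cchain_map h 0 = 0 by rewrite -(subrr 0) cchain_mapB subrr.
  exact: cyc_sum0.
by rewrite cchain_mapD; apply: (cyc_sumD Pd _ h2); apply: cyc_hom_map.
Qed.

Lemma cyc_diff_map (c : cchain A) :
  cyc_diff v (cchain_map h c) = cchain_map h (cyc_diff v c).
Proof.
apply/funext => i; rewrite /cchain_map /cyc_diff hoch_b_map connes_B_map.
by case: (u_range v i); rewrite ?(raddfD (formal_map h)) ?(raddf0 (formal_map h)).
Qed.

Lemma is_cycle_map (c : cchain A) : is_cycle v c -> is_cycle v (cchain_map h c).
Proof.
move=> [tc zc]; split; first exact: cyc_sum_map.
by rewrite cyc_diff_map => i; apply: formal_map_null.
Qed.

Lemma is_boundary_map (c : cchain A) :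
  is_boundary v c -> is_boundary v (cchain_map h c).
Proof.
move=> [e [te ce]]; exists (cchain_map h e); split; first exact: cyc_sum_map.
by rewrite cyc_diff_map -cchain_mapB => i; apply: formal_map_null.
Qed.

Lemma hc_mapE (c : cchain A) (x : HC A v) :
  represents c x -> represents (cchain_map h c) (hc_map h x).
Proof.
move=> [zc xc]; split; first exact: is_cycle_map.
have zr : is_cycle v (cycle_val (repr x)) by case: (repr x) => ? /= /asboolP.
have xr : x = hc_class v (cycle_val (repr x)) by rewrite /hc_class valKd reprK.
have bd : is_boundary v (c - cycle_val (repr x)).
  by apply: (iffLR (hc_class_eq zc zr)); apply: etrans (esym xc) xr.
have := is_boundary_map bd; rewrite cchain_mapB => bd'.
exact/esym/(iffRL (hc_class_eq (is_cycle_map zc) (is_cycle_map zr)) bd').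
Qed.

End HomologyMap.

(* z is the product of x and y: it is the class of the product of any cycles
   representing x and y. For v = Pos this is the action of HC^-_* on HC_*. *)
Definition hc_mul (A : gr_alg nat) (v v' : theory)
    (x : HC A v) (y : HC A v') (z : HC A v') : Prop :=
  forall c c' : cchain A, represents c x -> represents c' y ->
    represents (cyc_mul v' c c') z.

Record is_hc_alg_hom (R : comPzRingType) (A : gr_alg nat) (v : theory)
    (f : R -> HC A v) : Prop := IsHCAlgHom {
  hcah_add : {morph f : x y / x + y};
  hcah_one : represents (cyc_single 0 (1, [::])) (f 1);
  hcah_mul : forall x y, hc_mul (f x) (f y) (f (x * y))
}.

Record is_psi (A : gr_alg nat) (psi : ell A -> HC A Neg) : Prop := IsPsi {
  psi_hom : is_hc_alg_hom psi;
  psi_delta : forall a, represents (cyc_single 0 (1, [:: a])) (psi (ell_delta a));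
  psi_q : forall a, represents (cyc_single 0 (a, [:: a])) (psi (ell_q a));
  psi_phi : forall a,
    represents (cyc_single 0 (a ^+ 2, [::]) + cyc_single 1 (1, [:: a; a]))
               (psi (ell_phi a));
  psi_u : represents (cyc_single 1 (1, [::])) (psi (ell_u A))
}.

Record is_psi_per (A : gr_alg nat) (psi : ell_per A -> HC A Per) : Prop := IsPsiPer {
  psi_per_hom : is_hc_alg_hom psi;
  psi_per_q : forall a, represents (cyc_single 0 (a, [:: a])) (psi (per_q a));
  psi_per_phi : forall a,
    represents (cyc_single 0 (a ^+ 2, [::]) + cyc_single 1 (1, [:: a; a]))
               (psi (per_phi a));
  psi_per_u : represents (cyc_single 1 (1, [::])) (psi (per_u A));
  psi_per_uinv : represents (cyc_single (- 1) (1, [::])) (psi (per_uinv A))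
}.

Record is_psi_plus (A : gr_alg nat) (psi : ell A -> HC A Neg)
    (psip : ell_plus A -> HC A Pos) : Prop := IsPsiPlus {
  psi_plus_add : {morph psip : x y / x + y};
  psi_plus_scale : forall x y, hc_mul (psi x) (psip y) (psip (x *: y));
  psi_plus_gamma : forall a, represents (cyc_single 0 (a, [::])) (psip (plus_gamma a));
  psi_plus_v : forall i : nat,
    represents (cyc_single (- i%:Z) (1, [::])) (psip (plus_v A i))
}.

Section Uniqueness.
Variable A : gr_alg nat.

Lemma hc_mul_unique v v' (x : HC A v) (y : HC A v') z z' :
  hc_mul x y z -> hc_mul x y z' -> z = z'.
Proof.
have [c cx] := represents_ex x; have [c' cy] := represents_ex y.
by move=> /(_ _ _ cx cy)[_ ->] /(_ _ _ cx cy)[_ ->].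
Qed.

Lemma represents_unique v c (x y : HC A v) :
  represents c x -> represents c y -> x = y.
Proof. by move=> [_ ->] [_ ->]. Qed.

Lemma hc_hom_unique X (R : term X -> term X -> Prop) v (f g : presented R -> HC A v) :
  is_hc_alg_hom f -> is_hc_alg_hom g ->
  (forall x, f (pgen R x) = g (pgen R x)) -> f =1 g.
Proof.
move=> [fD f1 fM] [gD g1 gM] fg x; have [t ->] := pclass_surj x.
elim: t => {x} [x|||s IHs t IHt|s IHs t IHt]; first exact: fg.
- have z0 (k : presented R -> HC A v) : {morph k : x y / x + y} -> k 0 = 0.
    by move=> kD; apply: (addrI (k 0)); rewrite -kD !addr0.
  exact: etrans (z0 f fD) (esym (z0 g gD)).
- exact: represents_unique f1 g1.
- by rewrite pclassD fD gD IHs IHt.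
- rewrite pclassM; apply: hc_mul_unique (fM _ _) _; rewrite IHs IHt; exact: gM.
Qed.

(* The conditions above determine the approximations. *)
Lemma is_psi_unique (f g : ell A -> HC A Neg) : is_psi f -> is_psi g -> f =1 g.
Proof.
move=> [fh fd fq fp fu] [gh gd gq gp gu]; apply: hc_hom_unique fh gh _.
by case=> [a|a|a|]; [apply: represents_unique (fd a) (gd a)
  | apply: represents_unique (fp a) (gp a) | apply: represents_unique (fq a) (gq a)
  | apply: represents_unique fu gu].
Qed.

Lemma is_psi_per_unique (f g : ell_per A -> HC A Per) :
  is_psi_per f -> is_psi_per g -> f =1 g.
Proof.
move=> [fh fq fp fu fv] [gh gq gp gu gv]; apply: hc_hom_unique fh gh _.
by case=> [a|a||]; [apply: represents_unique (fp a) (gp a)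
  | apply: represents_unique (fq a) (gq a)
  | apply: represents_unique fu gu | apply: represents_unique fv gv].
Qed.

Lemma is_psi_plus_unique (psi : ell A -> HC A Neg) (f g : ell_plus A -> HC A Pos) :
  is_psi_plus psi f -> is_psi_plus psi g -> f =1 g.
Proof.
move=> [fD fM fg fv] [gD gM gg gv] x; have [t ->] := mclass_surj x.
elim: t => {x} [[a|i]||s IHs t IHt|a t IHt].
- exact: represents_unique (fg a) (gg a).
- exact: represents_unique (fv i) (gv i).
- have z0 (k : ell_plus A -> HC A Pos) : {morph k : x y / x + y} -> k 0 = 0.
    by move=> kD; apply: (addrI (k 0)); rewrite -kD !addr0.
  exact: etrans (z0 f fD) (esym (z0 g gD)).
- by rewrite mclassD fD gD IHs IHt.
- by rewrite mclassZ; apply: hc_mul_unique (fM _ _) _; rewrite IHt; apply: gM.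
Qed.

End Uniqueness.

(* The targets of the functors F are graded by an arbitrary abelian group G, and
   bidegrees (homological, upper) are converted into elements of G by tdeg: the
   identity of int * int gives bigraded targets, the two projections give targets
   graded by homological or by upper degree alone. *)
Section Transformations.
Variables (ungraded : bool) (G : zmodType) (tdeg : {additive (int * int)%type -> G}).

Record is_alg_transf (F : alg_functor ungraded G) (v : theory)
    (f : forall A : ft_alg ungraded, F A -> HC A v) : Prop := IsAlgTransf {
  at_hom : forall A : ft_alg ungraded, is_hc_alg_hom (f A);
  at_piece : forall (A : ft_alg ungraded) g x, ga_piece g x -> hc_piece tdeg g (f A x);
  at_natural : forall (A B : ft_alg ungraded) (h : gr_alg_hom A B) x,
    f B (af_map F h x) = hc_map h (f A x)
}.

Record is_mod_transf (F : mod_functor ungraded G) (v : theory)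
    (f : forall A : ft_alg ungraded, F A -> HC A v) : Prop := IsModTransf {
  mt_add : forall A : ft_alg ungraded, {morph f A : x y / x + y};
  mt_piece : forall (A : ft_alg ungraded) g x, gm_piece g x -> hc_piece tdeg g (f A x);
  mt_natural : forall (A B : ft_alg ungraded) (h : gr_alg_hom A B) x,
    f B (mf_map F h x) = hc_map h (f A x)
}.

(* Isomorphisms of graded objects have to reflect the grading. *)
Definition alg_iso_on_polynomials (F : alg_functor ungraded G) (v : theory)
    (f : forall A : ft_alg ungraded, F A -> HC A v) : Prop :=
  forall A : ft_alg ungraded, is_polynomial A ->
    bijective (f A) /\ (forall g x, hc_piece tdeg g (f A x) -> ga_piece g x).

Definition mod_iso_on_polynomials (F : mod_functor ungraded G) (v : theory)
    (f : forall A : ft_alg ungraded, F A -> HC A v) : Prop :=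
  forall A : ft_alg ungraded, is_polynomial A ->
    bijective (f A) /\ (forall g x, hc_piece tdeg g (f A x) -> gm_piece g x).

Record is_ell_transf (F : alg_functor ungraded G)
    (e : forall A : ft_alg ungraded, {rmorphism ell A -> F A}) : Prop :=
  IsEllTransf {
  et_piece : forall (A : ft_alg ungraded) d x, ell_piece d x -> ga_piece (tdeg d) (e A x);
  et_natural : forall (A B : ft_alg ungraded) (h : gr_alg_hom A B) x,
    e B (ell_map h x) = af_map F h (e A x)
}.

Record is_per_transf (F : alg_functor ungraded G)
    (e : forall A : ft_alg ungraded, {rmorphism ell_per A -> F A}) : Prop :=
  IsPerTransf {
  pt_piece : forall (A : ft_alg ungraded) d x, per_piece d x -> ga_piece (tdeg d) (e A x);
  pt_natural : forall (A B : ft_alg ungraded) (h : gr_alg_hom A B) x,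
    e B (per_map h x) = af_map F h (e A x)
}.

Record is_plus_transf (F : mod_functor ungraded G)
    (e : forall A : ft_alg ungraded, {additive ell_plus A -> F A}) : Prop :=
  IsPlusTransf {
  plt_piece : forall (A : ft_alg ungraded) d x, plus_piece d x -> gm_piece (tdeg d) (e A x);
  plt_natural : forall (A B : ft_alg ungraded) (h : gr_alg_hom A B) x,
    e B (plus_map h x) = mf_map F h (e A x)
}.

End Transformations.

(* Main.v *)
From HB Require Import structures.
From mathcomp Require Import all_boot all_fingroup all_algebra finmap.
From mathcomp Require Import boolp classical_sets functions fsbigop.
From mathcomp Require Import zify.
From mathcomp.multinomials Require Import monalg.
Require Import Defs.

Set Implicit Arguments.
Unset Strict Implicit.
Unset Printing Implicit Defensive.

Import generic_quotient GRing.Theory.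
Local Open Scope ring_scope.

(** Write an algebra A of finite type as the image of a graded map h : P -> A with P
    polynomial.  On P the transformation is forced to be e_P = f_P^-1 o psi_P, and on
    A one sets e_A (L h w) = F h (e_P w), where L is one of the three presented
    functors; then f o e = psi because f and psi are natural.  This is well defined
    because L preserves the relevant reflexive coequalizers: the kernel of L h is
    spanned by the differences L d0 w - L d1 w for reflexive pairs d0, d1 : Q -> P
    with Q polynomial and h o d0 = h o d1, and F h o e_P kills these by naturality.
    The spanning statement holds on generators, as p and p' in P with h p = h p'
    come from one element of some P[y_0, y_1, ...], and the span is an ideal (a submodule
    for ell^+) because the pairs are reflexive.  The functors F^+ carry no action of
    ell, so the degrees of e^+ are controlled on the polynomial side, where psi^+
    respects degrees and f reflects them. *)

(** * Polynomial algebras *)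

Lemma morph0 (U V : zmodType) (g : U -> V) : {morph g : x y / x + y} -> g 0 = 0.
Proof. by move=> gD; apply: (addrI (g 0)); rewrite -gD !addr0. Qed.

Lemma morphB (U V : zmodType) (g : U -> V) : {morph g : x y / x + y} ->
  {morph g : x y / x - y}.
Proof. by move=> gD x y; apply: (addIr (g y)); rewrite -gD !subrK. Qed.

Lemma mulrn_F2D (V : zmodType) (x : V) (c c' : 'F_2) : x + x = 0 ->
  x *+ (c + c')%R = x *+ c + x *+ c'.
Proof.
move=> x2; rewrite -mulrnDr [RHS](_ : _ = x *+ ((c + c') %% 2)%N) //.
rewrite [in LHS](divn_eq (c + c') 2) mulrnDr mulnC mulrnA mulr2n x2.
by rewrite mul0rn add0r.
Qed.

Section PolyEval.
Variables (A : comPzRingType) (I : choiceType) (x : I -> A).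
Hypothesis char2 : 1 + 1 = 0 :> A.
Implicit Types (m : {cmonom I}) (p q : {malg 'F_2[{cmonom I}]}).

Definition mon_eval m : A := \prod_(i <- finsupp m) x i ^+ m i.

Lemma mon_evalEw m (d : {fset I}) : (finsupp m `<=` d)%fset ->
  mon_eval m = \prod_(i <- d) x i ^+ m i.
Proof.
move=> le; rewrite /mon_eval; apply: big_fset_incl => // i _.
by rewrite -cmE_eq0 => /eqP ->; rewrite expr0.
Qed.

Lemma mon_eval1 : mon_eval mone = 1.
Proof. by rewrite /mon_eval mdom1 big_seq_fset0. Qed.

Lemma mon_evalU i : mon_eval (ucm i) = x i.
Proof. by rewrite /mon_eval mdomU big_seq_fset1 cmUU expr1. Qed.

Lemma mon_evalM m m' : mon_eval (mmul m m') = mon_eval m * mon_eval m'.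
Proof.
rewrite (@mon_evalEw m (finsupp m `|` finsupp m')%fset) ?fsubsetUl //.
rewrite (@mon_evalEw m' (finsupp m `|` finsupp m')%fset) ?fsubsetUr //.
rewrite -big_split /mon_eval mdomD; apply: eq_bigr => i _.
by rewrite cmM exprD.
Qed.

Lemma addrr2 (a : A) : a + a = 0.
Proof. by rewrite -[a]mul1r -mulrDl char2 mul0r. Qed.

Lemma poly_evalEw p (d : {fset {cmonom I}}) : (msupp p `<=` d)%fset ->
  poly_eval x p = \sum_(m <- d) mon_eval m *+ p@_m.
Proof.
move=> le; rewrite /poly_eval; apply: big_fset_incl => // m _.
by move/mcoeff_outdom ->; rewrite mulr0n.
Qed.

Lemma poly_evalD p q : poly_eval x (p + q) = poly_eval x p + poly_eval x q.
Proof.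
rewrite (@poly_evalEw _ (msupp p `|` msupp q)%fset) ?msuppD_le //.
rewrite (@poly_evalEw p (msupp p `|` msupp q)%fset) ?fsubsetUl //.
rewrite (@poly_evalEw q (msupp p `|` msupp q)%fset) ?fsubsetUr // -big_split.
by apply: eq_bigr => m _; rewrite mcoeffD mulrn_F2D ?addrr2.
Qed.

Lemma poly_evalB p q : poly_eval x (p - q) = poly_eval x p - poly_eval x q.
Proof.
apply: (addIr (poly_eval x q)).
by rewrite -poly_evalD -!addrA !addNr !addr0.
Qed.

Lemma poly_eval_mon m : poly_eval x << m >> = mon_eval m.
Proof.
by rewrite (@poly_evalEw _ [fset m]%fset) ?msuppU_le // big_seq_fset1 mcoeffUU.
Qed.

Lemma poly_evalU i : poly_eval x << ucm i >> = x i.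
Proof. by rewrite poly_eval_mon mon_evalU. Qed.

Lemma poly_eval1 : poly_eval x 1 = 1.
Proof. by rewrite [1]/(<< mone >>) poly_eval_mon mon_eval1. Qed.

Lemma mulm_mon m m' : << m >> * << m' >> = << mmul m m' >> :> {malg 'F_2[{cmonom I}]}.
Proof. by rewrite malgM_def fgmulUU mulr1. Qed.

Lemma poly_evalM p q : poly_eval x (p * q) = poly_eval x p * poly_eval x q.
Proof.
pose f := HB.pack_for {additive {malg 'F_2[{cmonom I}]} -> A} (poly_eval x)
  (GRing.isZmodMorphism.Build _ _ (poly_eval x) poly_evalB).
have fE r : poly_eval x r = f r by [].
rewrite [p]malg_F2E [q]malg_F2E !fE mulr_suml !raddf_sum mulr_suml.
apply: eq_bigr => m _; rewrite mulr_sumr !raddf_sum mulr_sumr.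
apply: eq_bigr => m' _.
by rewrite mulm_mon; apply: etrans (poly_eval_mon _) _; rewrite mon_evalM -!poly_eval_mon.
Qed.
End PolyEval.

Section FreeAlgebra.
Variable n : nat -> nat.
Local Notation I := {s : nat & 'I_(n s)}.
Local Notation P := {malg 'F_2[{cmonom I}]}.
Implicit Types (m : {cmonom I}) (p q : P).

Definition weight m : nat := (\sum_(i <- finsupp m) m i * tag i)%N.

Lemma weightEw m (d : {fset I}) : (finsupp m `<=` d)%fset ->
  weight m = (\sum_(i <- d) m i * tag i)%N.
Proof.
move=> le; rewrite /weight; apply: big_fset_incl => // i _.
by rewrite -cmE_eq0 => /eqP ->.
Qed.

Lemma weight1 : weight mone = 0%N.
Proof. by rewrite /weight mdom1 big_seq_fset0. Qed.

Lemma weightU i : weight (ucm i) = tag i.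
Proof. by rewrite /weight mdomU big_seq_fset1 cmUU mul1n. Qed.

Lemma weightM m m' : weight (mmul m m') = (weight m + weight m')%N.
Proof.
rewrite (@weightEw m (finsupp m `|` finsupp m')%fset) ?fsubsetUl //.
rewrite (@weightEw m' (finsupp m `|` finsupp m')%fset) ?fsubsetUr //.
rewrite -big_split /weight mdomD; apply: eq_bigr => i _.
by rewrite cmM mulnDl.
Qed.

Definition free_piece (s : nat) p : Prop := forall m, m \in msupp p -> weight m = s.

Lemma free_piece_mon m : free_piece (weight m) << m >>.
Proof. by move=> m'; rewrite msuppU1 => /fset1P ->. Qed.

Lemma free_pieceB s p q : free_piece s p -> free_piece s q -> free_piece s (p - q).
Proof.
by move=> hp hq m /(fsubsetP (msuppB_le _ _)) /fsetUP[/hp|/hq].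
Qed.

Lemma free_piece0 s : free_piece s 0.
Proof. by move=> m; rewrite msupp0. Qed.

Lemma free_piece_sum s (J : Type) (r : seq J) (D : pred J) (F : J -> P) :
  (forall j, D j -> free_piece s (F j)) -> free_piece s (\sum_(j <- r | D j) F j).
Proof.
move=> hF; elim/big_ind: _ => //; first exact: free_piece0.
move=> p q hp hq; rewrite -[q]opprK; apply: free_pieceB => //.
by rewrite -sub0r; apply: free_pieceB => //; apply: free_piece0.
Qed.

Lemma free_grading : is_grading free_piece.
Proof.
split; [exact: free_piece0 | exact: free_pieceB | move=> p | move=> r x ur hx x0 i ir].
- exists [fset weight m | m in msupp p]%fset.
  exists (fun s => \sum_(m <- msupp p | weight m == s) << m >>); split.
    by move=> s; apply: free_piece_sum => m /eqP <-; apply: free_piece_mon.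
  by rewrite [LHS]malg_F2E (partition_big_imfset _ weight).
- apply/malgP => m; rewrite mcoeff0.
  have [e|ne] := eqVneq (weight m) i; last first.
    by apply/eqP; rewrite mcoeff_eq0; apply/negP => /hx e; rewrite e eqxx in ne.
  have := congr1 (mcoeff m) x0; rewrite mcoeff0 raddf_sum /=.
  rewrite (bigD1_seq i) //= big1 ?addr0 // => j ji.
  apply/eqP; rewrite mcoeff_eq0; apply/negP => /hx; rewrite e => ij.
  by rewrite ij eqxx in ji.
Qed.

Lemma free_piece1 : free_piece 0 1.
Proof. by have := @free_piece_mon mone; rewrite weight1. Qed.

Lemma free_pieceM s t p q :
  free_piece s p -> free_piece t q -> free_piece (s + t)%N (p * q).
Proof.
move=> hp hq; rewrite [p]malg_F2E [q]malg_F2E mulr_suml big_seq.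
apply: free_piece_sum => m /hp <-; rewrite mulr_sumr big_seq.
apply: free_piece_sum => m' /hq <-; rewrite mulm_mon -weightM.
exact: free_piece_mon.
Qed.

Lemma free_char2 : 1 + 1 = 0 :> P.
Proof.
apply/malgP => m; rewrite mcoeffD mcoeff0 mcoeff1.
by case: (m == _); rewrite ?addr0 //; apply/val_inj.
Qed.

Definition free_alg : gr_alg nat :=
  GrAlg free_char2 free_grading free_piece1 free_pieceM.

Definition free_var (i : I) : free_alg := << ucm i >>.

Lemma free_var_piece (i : I) : ga_piece (tag i) (free_var i).
Proof. by rewrite -weightU; apply: free_piece_mon. Qed.

Lemma pow_ucm i k : exists m,
  (<< ucm i >> : P) ^+ k = << m >> /\ forall j, m j = (k * (i == j))%N.
Proof.
elim: k => [|k [m [em hm]]]; first by exists mone; split=> // j; rewrite cm1.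
exists (mmul (ucm i) m); split.
  by rewrite exprS em; exact: mulm_mon.
by move=> j; rewrite cmM cmU hm mulSn.
Qed.

Lemma mon_eval_var m : mon_eval free_var m = << m >>.
Proof.
have H (r : seq I) : exists m', (\prod_(i <- r) free_var i ^+ m i = << m' >> :> P)
    /\ forall j, m' j = (\sum_(i <- r) m i * (i == j))%N.
  elim: r => [|i r [m' [em' hm']]].
    by exists mone; rewrite big_nil; split=> // j; rewrite big_nil cm1.
  have [m1 [em1 hm1]] := pow_ucm i (m i); exists (mmul m1 m'); split=> [|j].
    by rewrite big_cons; apply: etrans (congr2 ( *%R) em1 em') (mulm_mon _ _).
  by rewrite big_cons cmM hm1 hm'.
have [m' [em' hm']] := H (finsupp m); rewrite /mon_eval em'.
congr << _ >>; apply/eqP/cmP => j; rewrite hm'.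
have [jm|jm] := boolP (j \in finsupp m).
  rewrite (bigD1_seq j) //= eqxx muln1 big1 ?addn0 // => i ij.
  by rewrite (negPf ij) muln0.
rewrite big_seq big1 => [|i im]; first by apply/esym/eqP; rewrite cmE_eq0.
by case: eqP im jm => [->->|] //; rewrite muln0.
Qed.

Lemma poly_eval_var p : poly_eval free_var p = p.
Proof.
rewrite [RHS]malg_F2E /poly_eval; apply: eq_big_seq => m mp.
rewrite -[X in X *+ _]/(mon_eval free_var m) mon_eval_var.
move: mp; rewrite -mcoeff_neq0; case: (p@_m) => -[|[|//]] //= ? _.
Qed.

Lemma free_is_polynomial : is_polynomial free_alg.
Proof.
exists n, free_var; split; first exact: free_var_piece.
by exists id => p; apply: poly_eval_var.
Qed.

Lemma free_generated : generated_by (fun x => exists i, x = free_var i).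
Proof.
move=> T T1 TB TM Tv p.
have T0 : T 0 by rewrite -(subrr 1); apply: (TB).
have TD q r : T q -> T r -> T (q + r).
  by move=> Tq Tr; rewrite -[r]opprK; apply: (TB) => //; rewrite -sub0r; apply: (TB).
rewrite -[p]poly_eval_var /poly_eval; elim/big_ind: _ => // m _.
suff Tm : T (mon_eval free_var m).
  by elim: (nat_of_ord _) => [|k IH]; rewrite ?mulr0n // mulrS; apply: (TD).
rewrite /mon_eval; elim/big_ind: _ => // i _.
elim: (m i) => [|k IH]; first by rewrite expr0; exact: T1.
by rewrite exprS; apply: (TM) IH; apply: (Tv); exists i.
Qed.

Lemma free_finite_type : finite_type free_alg.
Proof.
exists (fun s => [seq free_var (existT _ s i : I) | i <- enum 'I_(n s)]); split.
  move=> s x /mapP[i _ ->]. exact: (@free_var_piece (existT _ s i)).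
move=> T T1 TB TM Tv; apply: free_generated => // _ [[s i] ->]; apply: (Tv).
by exists s; apply: map_f; rewrite mem_enum.
Qed.

Section Hom.
Variables (A : gr_alg nat) (x : I -> A).
Hypothesis xP : forall i, ga_piece (tag i) (x i).

Lemma piece_poly_eval s p : free_piece s p -> ga_piece s (poly_eval x p).
Proof.
move=> hp; have [p0 pB _ _] := ga_grading A; have p1 := ga_piece1 A.
have pD t (a b : A) : ga_piece t a -> ga_piece t b -> ga_piece t (a + b).
  by move=> ha hb; rewrite -[b]opprK; apply: (pB) => //; rewrite -sub0r; apply: (pB).
rewrite /poly_eval big_seq; elim/big_ind: _ => //; first exact: (pD).
move=> m /hp <-; rewrite -[X in X *+ _]/(mon_eval x m).
suff Tm : ga_piece (weight m) (mon_eval x m).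
  by elim: (nat_of_ord _) => [|k IH]; rewrite ?mulr0n // mulrS; apply: (pD).
rewrite /mon_eval /weight; elim/big_ind2: _ => // [? ? ? ?|i _].
  exact: ga_pieceM.
elim: (m i) => [|k IH]; first by rewrite expr0; exact: p1.
by rewrite exprS mulSn; exact: ga_pieceM (xP i) IH.
Qed.

Definition free_rmorphism : {rmorphism free_alg -> A} :=
  HB.pack_for {rmorphism free_alg -> A} (poly_eval x : free_alg -> A)
    (GRing.isZmodMorphism.Build _ _ (poly_eval x : free_alg -> A)
       (poly_evalB x (ga_char2 A)))
    (GRing.isMonoidMorphism.Build _ _ (poly_eval x : free_alg -> A)
       (poly_eval1 x, poly_evalM x (ga_char2 A))).

Definition free_hom : gr_alg_hom free_alg A :=
  GrAlgHom (gah_fun := free_rmorphism) piece_poly_eval.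

Lemma free_homE i : free_hom (free_var i) = x i.
Proof. exact: poly_evalU. Qed.

End Hom.

Lemma free_hom_ext (A : comPzRingType) (f g : {rmorphism free_alg -> A}) :
  (forall i, f (free_var i) = g (free_var i)) -> f =1 g.
Proof.
move=> fg; apply: free_generated; first by rewrite !rmorph1.
- by move=> p q fp fq; rewrite !rmorphB fp fq.
- by move=> p q fp fq; rewrite !rmorphM fp fq.
- by move=> _ [i ->].
Qed.

End FreeAlgebra.

Section Gradings.
Variables (I : choiceType) (V : zmodType) (P : I -> V -> Prop).
Hypothesis gP : is_grading P.

Lemma gradingD i x y : P i x -> P i y -> P i (x + y).
Proof.
move=> px py; rewrite -[y]opprK; apply: (gradingB gP) => //.
by rewrite -sub0r; apply: (gradingB gP) => //; apply: grading0.
Qed.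

Lemma gradingMn i x k : P i x -> P i (x *+ k).
Proof.
move=> px; elim: k => [|k IH]; first by rewrite mulr0n; apply: grading0.
by rewrite mulrS; apply: gradingD.
Qed.

Lemma grading_decomp v : exists (r : seq I) (x : I -> V),
  [/\ uniq r, forall i, P i (x i) & v = \sum_(i <- r) x i].
Proof.
have [r [x [px ->]]] := grading_span gP v.
exists (undup r), (fun i => x i *+ count_mem i r); split=> [||].
- exact: undup_uniq.
- by move=> i; apply: gradingMn.
- by rewrite -(big_undup_iterop_count (idx := 0)).
Qed.

Lemma grading_disjoint i j x : i != j -> P i x -> P j x -> x = 0.
Proof.
move=> ij pi pj; have [p0 pB _ direct] := gP.
pose f k := if k == i then x else if k == j then - x else 0.
suff: f i = 0 by rewrite /f eqxx.
apply: (direct [:: i; j]).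
- by rewrite /= inE ij.
- move=> k; rewrite /f; case: eqP => [->|_] //; case: eqP => [->|_] //.
  by rewrite -sub0r; apply: (pB).
- by rewrite !big_cons big_nil /f !eqxx eq_sym (negPf ij) addr0 subrr.
- by rewrite inE eqxx.
Qed.

End Gradings.

Lemma surj_piece (A B : gr_alg nat) (h : gr_alg_hom A B) s b :
  (forall y, exists x, h x = y) -> ga_piece s b ->
  exists2 a, ga_piece s a & h a = b.
Proof.
move=> hsurj pb; have [a ha] := hsurj b.
have [r [x [ur px ax]]] := grading_decomp (ga_grading A) a.
pose y i := if i == s then h (x i *+ (s \in r)) - b else h (x i).
have py i : ga_piece i (y i).
  rewrite /y; case: eqP => [->|_]; last exact: gah_piece.
  apply: (gradingB (ga_grading B)) => //; apply: gah_piece.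
  exact/(gradingMn (ga_grading A))/px.
exists (x s *+ (s \in r)); first exact/(gradingMn (ga_grading A))/px.
apply/eqP; rewrite -subr_eq0; apply/eqP.
have -> : h (x s *+ (s \in r)) - b = y s by rewrite /y eqxx.
apply: (grading_direct (ga_grading B) (r := s :: rem s r)) => //.
- by rewrite /= rem_uniq // mem_rem_uniq // inE eqxx.
- have E : \sum_(i <- rem s r) y i = \sum_(i <- rem s r) h (x i).
    apply: eq_big_seq => i; rewrite mem_rem_uniq // inE => /andP[/negPf ne _].
    by rewrite /y ne.
  rewrite big_cons E /y eqxx -ha ax raddf_sum /=.
  have [sr|sr] := boolP (s \in r).
    by rewrite (big_rem s sr) /= mulr1n opprD addrA subrr sub0r addNr.
  by rewrite rem_id // mulr0n raddf0 sub0r addNr.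
- by rewrite inE eqxx.
Qed.

Section FreeFT.
Variable ungraded : bool.
Implicit Types A B : ft_alg ungraded.

Lemma ft_piece_eq0 A s (x : A) : ungraded && (s != 0%N) -> ga_piece s x -> x = 0.
Proof.
move=> /andP[ug s0] px.
exact: (grading_disjoint (ga_grading A) s0 px (fta_ungraded ug x)).
Qed.

Definition admissible (n : nat -> nat) : Prop :=
  forall s, ungraded && (s != 0%N) -> n s = 0%N.

Lemma free_ungraded n : admissible n ->
  ungraded -> forall x : free_alg n, ga_piece 0%N x.
Proof.
move=> hn ug x m _; rewrite /weight big1 // => -[s i] _ /=.
have [s0|s0] := eqVneq s 0%N; first by rewrite [X in (_ * X)%N]s0 muln0.
by have := ltn_ord i; rewrite {2}hn // ug s0.
Qed.

Definition free_ft n (hn : admissible n) : ft_alg ungraded :=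
  FtAlg (free_finite_type n) (free_ungraded hn).

Lemma free_cover A : exists n (hn : admissible n) (h : gr_alg_hom (free_ft hn) A),
  forall y, exists x, h x = y.
Proof.
have [gen [pgen gengen]] := fta_finite A.
pose n s := if ungraded && (s != 0%N) then 0%N else size (gen s).
have hn : admissible n by move=> s us; rewrite /n us.
pose x (i : {s : nat & 'I_(n s)}) : A := nth 0 (gen (tag i)) (tagged i).
have px i : ga_piece (tag i) (x i).
  case: i => s i; apply: pgen; rewrite mem_nth //.
  by have := ltn_ord i; rewrite [X in (_ < X)%N -> _]/n; case: ifP.
exists n, hn, (free_hom px); apply: gengen.
- by exists 1; apply: rmorph1.
- by move=> _ _ [a <-] [b <-]; exists (a - b); apply: rmorphB.
- by move=> _ _ [a <-] [b <-]; exists (a * b); apply: rmorphM.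
- move=> b [s bs]; have [us|us] := boolP (ungraded && (s != 0%N)).
    by exists 0; rewrite (ft_piece_eq0 us (pgen _ _ bs)) raddf0.
  have lt : (index b (gen s) < n s)%N by rewrite /n (negPf us) index_mem.
  exists (free_var (existT _ s (Ordinal lt))).
  by rewrite (free_homE px) /x /= nth_index.
Qed.

Lemma free_lift n (hn : admissible n) A B (h : gr_alg_hom B A)
    (k : gr_alg_hom (free_ft hn) A) : (forall y, exists x, h x = y) ->
  exists l : gr_alg_hom (free_ft hn) B, forall x, h (l x) = k x.
Proof.
move=> hsurj.
have H (i : {s : nat & 'I_(n s)}) : exists b : B,
    ga_piece (tag i) b /\ h b = k (free_var i).
  have [b pb hb] := surj_piece hsurj (gah_piece k (@free_var_piece n i)).
  by exists b.
have [x xP] := choice H.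
pose l := free_hom (fun i => (xP i).1).
exists l; move=> p; pose hl := GRing.RMorphism.clone _ _ (h \o l) _.
apply: (@free_hom_ext _ _ hl k) => i; rewrite /hl /= -(xP i).2.
exact: congr1 (free_homE (fun i => (xP i).1) i).
Qed.

Record refl_pair (A P Q : ft_alg ungraded) (h : gr_alg_hom P A)
    (i : gr_alg_hom P Q) (d0 d1 : gr_alg_hom Q P) : Prop := ReflPair {
  rp_poly : is_polynomial Q;
  rp_id0 : forall x, d0 (i x) = x;
  rp_id1 : forall x, d1 (i x) = x;
  rp_eq : forall x, h (d0 x) = h (d1 x)
}.

Lemma free_refl_pair n (hn : admissible n) A (h : gr_alg_hom (free_ft hn) A) p p' :
  h p = h p' -> exists (Q : ft_alg ungraded) (i : gr_alg_hom (free_ft hn) Q)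
    (d0 d1 : gr_alg_hom Q (free_ft hn)) (y : Q),
    [/\ refl_pair h i d0 d1, d0 y = p & d1 y = p'].
Proof.
move=> epp'; set P := free_ft hn in h p p' epp' *.
have [r [x [ur px dx]]] := grading_decomp (ga_grading P) (p - p').
have hx0 j : j \in r -> h (x j) = 0.
  move=> jr; apply: (grading_direct (ga_grading A) (x := fun k => h (x k)) ur _ _ jr).
    by move=> k; apply: gah_piece.
  have hz : h (p - p') = 0 by rewrite rmorphB /= epp' subrr.
  by rewrite dx raddf_sum in hz.
pose c s := if ungraded && (s != 0%N) then 0%N else 1%N.
pose m s := (n s + c s)%N.
have hm : admissible m by move=> s us; rewrite /m /c us hn.
have pi (j : {s : nat & 'I_(n s)}) :
    ga_piece (tag j) (free_var (existT _ (tag j) (lshift (c (tag j)) (tagged j))) : free_ft hm).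
  exact: (@free_var_piece m (existT _ (tag j) (lshift (c (tag j)) (tagged j)))).
pose z s : P := if s \in r then x s else 0.
have pz s : ga_piece s (z s).
  by rewrite /z; case: ifP => // _; apply: (grading0 (ga_grading P)).
pose d (t : nat -> P) (j : {s : nat & 'I_(m s)}) : P :=
  match fintype.split (tagged j) with
  | inl k => free_var (existT (fun s => 'I_(n s)) (tag j) k)
  | inr _ => t (tag j)
  end.
have pd t : (forall s, ga_piece s (t s)) -> forall j, ga_piece (tag j) (d t j).
  move=> pt [s j]; rewrite /d; case: fintype.split => /= [k|_]; last exact: pt.
  exact: (@free_var_piece n (existT _ s k)).
have p0 s : ga_piece s (0 : P) by apply: (grading0 (ga_grading P)).
pose d0 := free_hom (pd z pz); pose d1 := free_hom (pd (fun=> 0) p0).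
pose i := free_hom pi.
have di t pt y : free_hom (pd t pt) (i y) = y.
  pose f := GRing.RMorphism.clone _ _ (free_hom (pd t pt) \o i) _.
  pose g : {rmorphism P -> P} := idfun.
  apply: (@free_hom_ext _ _ f g) => -[s j]; rewrite /f /g /=.
  apply: etrans (congr1 (free_hom (pd t pt)) (free_homE pi (existT _ s j))) _.
  rewrite (free_homE (pd t pt)) /d /=.
  by rewrite -[lshift _ j]/(unsplit (inl j)) unsplitK.
pose w s : free_ft hm :=
  match ltnP 0 (c s) with LtnNotGeq lt => free_var (existT _ s (rshift (n s) (Ordinal lt)))
  | _ => 0 end.
have dw t pt s : (0 < c s)%N -> free_hom (pd t pt) (w s) = t s.
  rewrite /w; case: ltnP => // lt _; rewrite (free_homE (pd t pt)) /d /=.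
  by rewrite -[rshift _ (Ordinal lt)]/(unsplit (inr (Ordinal lt))) unsplitK.
have dw' s : d0 (w s) = z s.
  have [lt|le] := ltnP 0 (c s); first exact: dw.
  rewrite (_ : w s = 0); last by rewrite /w; case: ltnP => // lt; rewrite leqNgt lt in le.
  rewrite raddf0; apply/esym/(ft_piece_eq0 _ (pz s)).
  by move: le; rewrite /c; case: ifP.
have d1w s : d1 (w s) = 0.
  have [lt|le] := ltnP 0 (c s); first exact: dw.
  rewrite (_ : w s = 0) ?raddf0 //.
  by rewrite /w; case: ltnP => // lt; rewrite leqNgt lt in le.
exists (free_ft hm), i, d0, d1, (i p' + \sum_(s <- r) w s); split.
- split=> [|y|y|y]; [exact: free_is_polynomial | exact: di | exact: di |].
  pose f := GRing.RMorphism.clone _ _ (h \o d0) _.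
  pose g := GRing.RMorphism.clone _ _ (h \o d1) _.
  apply: (@free_hom_ext _ _ f g) => -[s j]; rewrite /f /g /=.
  apply: etrans (congr1 h (free_homE (pd z pz) _)) _.
  apply: etrans (congr1 h (esym (free_homE (pd (fun=> 0) p0) _))).
  rewrite /d /=; case: fintype.split => //= _; rewrite raddf0 /z.
  by case: ifP => [/hx0 //|_]; apply: raddf0.
- rewrite rmorphD -[RHS](subrK p') dx addrC; congr (_ + _); last exact: di.
  by rewrite raddf_sum; apply: eq_big_seq => s sr; rewrite [LHS]dw' /z sr.
- rewrite rmorphD -[RHS]addr0; congr (_ + _); first exact: di.
  by rewrite raddf_sum; apply: big1 => s _; apply: d1w.
Qed.

End FreeFT.

(** * Kernels of maps of presented objects *)

Section PresentedKernel.
Variables (X Y : Type) (R : term X -> term X -> Prop) (S : term Y -> term Y -> Prop).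
Variables (f : X -> Y) (sec : Y -> X).
Hypothesis fRS : forall s t, R s t -> S (term_map f s) (term_map f t).
Hypothesis secK : forall y, f (sec y) = y.
Hypothesis lift_rel : forall s t, S s t ->
  exists s' t', [/\ R s' t', term_map f s' = s & term_map f t' = t].

Variable E : presented R -> presented R -> Prop.
Hypothesis Erefl : forall x, E x x.
Hypothesis Esym : forall x y, E x y -> E y x.
Hypothesis Etrans : forall x y z, E x y -> E y z -> E x z.
Hypothesis ED : forall x x' y y', E x x' -> E y y' -> E (x + y) (x' + y').
Hypothesis EM : forall x x' y y', E x x' -> E y y' -> E (x * y) (x' * y').
Hypothesis Egen : forall x x', f x = f x' -> E (pgen R x) (pgen R x').

Lemma term_map_sec t : term_map f (term_map sec t) = t.
Proof. by elim: t => //= [y|s -> t ->|s -> t ->] //; rewrite secK. Qed.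

Lemma presented_map_surj (y : presented S) : exists x : presented R, presented_map S f x = y.
Proof.
have [t ->] := pclass_surj y; exists (pclass R (term_map sec t)).
by rewrite (presented_mapE fRS) term_map_sec.
Qed.

Lemma term_map_inj s t : term_map f s = term_map f t -> E (pclass R s) (pclass R t).
Proof.
elim: s t => [x|||s1 IH1 s2 IH2|s1 IH1 s2 IH2] [x'|||t1 t2|t1 t2] //=.
- by case=> /Egen.
- by case=> /IH1 e1 /IH2 e2; rewrite !pclassD; apply: ED.
- by case=> /IH1 e1 /IH2 e2; rewrite !pclassM; apply: EM.
Qed.

Lemma presented_map_ker (a b : presented R) :
  presented_map S f a = presented_map S f b -> E a b.
Proof.
have [s ->] := pclass_surj a; have [t ->] := pclass_surj b.
rewrite !(presented_mapE fRS) => /pclassP st.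
suff {a b} H u v : term_cong S u v ->
    E (pclass R (term_map sec u)) (pclass R (term_map sec v)).
  apply: (Etrans (y := pclass R (term_map sec (term_map f s)))).
    by apply: term_map_inj; rewrite term_map_sec.
  by apply: Etrans (H _ _ st) _; apply: term_map_inj; rewrite term_map_sec.
elim=> {u v s t st} /=.
- move=> s t /lift_rel[s' [t' [rs es et]]].
  apply: (Etrans (y := pclass R s')); first by apply: term_map_inj; rewrite term_map_sec.
  have -> : pclass R s' = pclass R t' by apply/pclassP/cong_rel.
  by apply: term_map_inj; rewrite term_map_sec.
- by move=> t; apply: Erefl.
- by move=> s t _; apply: Esym.
- by move=> s t r _ st _; apply: Etrans.
- by move=> s s' t t' _ e _ e'; rewrite !pclassD; apply: ED.
- by move=> s s' t t' _ e _ e'; rewrite !pclassM; apply: EM.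
- by move=> s t r; rewrite !pclassD addrA.
- by move=> s t; rewrite !pclassD addrC.
- by move=> t; rewrite !pclassD add0r.
- move=> t; rewrite !pclassD -{1}[pclass R _]poppE addNr; exact: Erefl.
- by move=> s t r; rewrite !pclassM mulrA.
- by move=> s t; rewrite !pclassM mulrC.
- by move=> t; rewrite !pclassM mul1r.
- by move=> s t r; rewrite !(pclassD, pclassM) mulrDl.
Qed.

End PresentedKernel.

Section PresentedModKernel.
Variables (L M : comPzRingType) (X Y : Type).
Variables (R : mterm L X -> mterm L X -> Prop) (S : mterm M Y -> mterm M Y -> Prop).
Variables (g : {rmorphism L -> M}) (f : X -> Y) (sec : Y -> X).
Hypothesis fRS : forall s t, R s t -> S (mterm_map g f s) (mterm_map g f t).
Hypothesis gsurj : forall a, exists b, g b = a.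
Hypothesis secK : forall y, f (sec y) = y.
Hypothesis lift_rel : forall s t, S s t ->
  exists s' t', [/\ R s' t', mterm_map g f s' = s & mterm_map g f t' = t].

Lemma mterm_map_surj t : exists t', mterm_map g f t' = t.
Proof.
elim: t => [y||_ [s <-] _ [t <-]|a _ [t <-]].
- by exists (MGen (sec y)); rewrite /= secK.
- by exists MZero.
- by exists (MAdd s t).
- by have [b <-] := gsurj a; exists (MScale b t).
Qed.

Lemma presented_mod_map_surj (y : presented_mod S) :
  exists x : presented_mod R, presented_mod_map S g f x = y.
Proof.
have [t ->] := mclass_surj y; have [t' <-] := mterm_map_surj t.
by exists (mclass R t'); rewrite (presented_mod_mapE fRS).
Qed.

Variable E : presented_mod R -> presented_mod R -> Prop.
Hypothesis Erefl : forall x, E x x.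
Hypothesis Esym : forall x y, E x y -> E y x.
Hypothesis Etrans : forall x y z, E x y -> E y z -> E x z.
Hypothesis ED : forall x x' y y', E x x' -> E y y' -> E (x + y) (x' + y').
Hypothesis EZ : forall a a' y y', g a = g a' -> E y y' -> E (a *: y) (a' *: y').
Hypothesis Egen : forall x x', f x = f x' -> E (mgen R x) (mgen R x').

Lemma mterm_map_inj s t : mterm_map g f s = mterm_map g f t -> E (mclass R s) (mclass R t).
Proof.
elim: s t => [x||s1 IH1 s2 IH2|a s IH] [x'||t1 t2|b t] //=.
- by case=> /Egen.
- by case=> /IH1 e1 /IH2 e2; rewrite !mclassD; apply: ED.
- by case=> e /IH e2; rewrite !mclassZ; apply: EZ.
Qed.

Lemma presented_mod_map_ker (a b : presented_mod R) :
  presented_mod_map S g f a = presented_mod_map S g f b -> E a b.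
Proof.
have [s ->] := mclass_surj a; have [t ->] := mclass_surj b.
rewrite !(presented_mod_mapE fRS) => /mclassP st.
have E0 u v : mclass R u = mclass R v -> E (mclass R u) (mclass R v) by move=> ->.
suff {a b} : exists s' t', [/\ mterm_map g f s' = mterm_map g f s,
    mterm_map g f t' = mterm_map g f t & E (mclass R s') (mclass R t')].
  move=> [s' [t' [/esym es et e]]].
  exact: Etrans (mterm_map_inj es) (Etrans e (mterm_map_inj et)).
elim: st => {s t}.
- move=> s t /lift_rel[s' [t' [rs es et]]]; exists s', t'; split=> //.
  by apply: E0; apply/mclassP/mcong_rel.
- by move=> t; have [t' et] := mterm_map_surj t; exists t', t'.
- by move=> s t _ [s' [t' [es et e]]]; exists t', s'; split=> //; apply: Esym.
- move=> s t r _ [s' [t' [es et e]]] _ [t2 [r' [et2 er e']]].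
  exists s', r'; split=> //; apply: Etrans e (Etrans _ e').
  by apply: mterm_map_inj; rewrite et2.
- move=> s1 s2 t1 t2 _ [s' [s'' [<- <- e]]] _ [t' [t'' [<- <- e']]].
  by exists (MAdd s' t'), (MAdd s'' t''); split=> //; rewrite !mclassD; apply: ED.
- move=> b t1 t2 _ [t' [t'' [<- <- e]]]; have [c <-] := gsurj b.
  by exists (MScale c t'), (MScale c t''); split=> //; rewrite !mclassZ; apply: EZ.
- move=> s t r; have [s' <-] := mterm_map_surj s; have [t' <-] := mterm_map_surj t.
  have [r' <-] := mterm_map_surj r.
  exists (MAdd s' (MAdd t' r')), (MAdd (MAdd s' t') r'); split=> //.
  by apply: E0; rewrite !mclassD addrA.
- move=> s t; have [s' <-] := mterm_map_surj s; have [t' <-] := mterm_map_surj t.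
  exists (MAdd s' t'), (MAdd t' s'); split=> //.
  by apply: E0; rewrite !mclassD addrC.
- move=> t; have [t' <-] := mterm_map_surj t; exists (MAdd MZero t'), t'; split=> //.
  by apply: E0; rewrite !mclassD add0r.
- move=> t; have [t' <-] := mterm_map_surj t.
  exists (MAdd (MScale (-1) t') t'), MZero; split=> //=; first by rewrite rmorphN1.
  by apply: E0; rewrite !mclassD mclassZ scaleN1r addNr.
- move=> b c t; have [t' <-] := mterm_map_surj t.
  have [b' <-] := gsurj b; have [c' <-] := gsurj c.
  exists (MScale b' (MScale c' t')), (MScale (b' * c') t'); split=> //=.
    by rewrite rmorphM.
  by apply: E0; rewrite !mclassZ scalerA.
- move=> t; have [t' <-] := mterm_map_surj t; exists (MScale 1 t'), t'; split=> //=.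
    by rewrite rmorph1.
  by apply: E0; rewrite !mclassZ scale1r.
- move=> b s t; have [s' <-] := mterm_map_surj s; have [t' <-] := mterm_map_surj t.
  have [b' <-] := gsurj b.
  exists (MScale b' (MAdd s' t')), (MAdd (MScale b' s') (MScale b' t')); split=> //.
  by apply: E0; rewrite !(mclassD, mclassZ) scalerDr.
- move=> b c t; have [t' <-] := mterm_map_surj t.
  have [b' <-] := gsurj b; have [c' <-] := gsurj c.
  exists (MScale (b' + c') t'), (MAdd (MScale b' t') (MScale c' t')); split=> //=.
    by rewrite rmorphD.
  by apply: E0; rewrite !(mclassD, mclassZ) scalerDl.
Qed.

End PresentedModKernel.

Section TermMapFunctoriality.
Variables (X Y Z : Type) (f : X -> Y) (g : Y -> Z) (k : X -> Z).

Lemma term_map_comp t : k =1 g \o f -> term_map k t = term_map g (term_map f t).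
Proof. by move=> e; elim: t => //= [x|s -> t ->|s -> t ->] //; rewrite e. Qed.

Lemma term_map_id (e : X -> X) t : e =1 id -> term_map e t = t.
Proof. by move=> eid; elim: t => //= [x|s -> t ->|s -> t ->] //; rewrite eid. Qed.

Variables (L M N : comPzRingType) (p : L -> M) (q : M -> N) (r : L -> N).

Lemma mterm_map_comp t : r =1 q \o p -> k =1 g \o f ->
  mterm_map r k t = mterm_map q g (mterm_map p f t).
Proof.
move=> e e'; elim: t => //= [x|s -> t ->|a t ->] //; first by rewrite e'.
by rewrite e.
Qed.

Lemma mterm_map_id (c : L -> L) (e : X -> X) t : c =1 id -> e =1 id ->
  mterm_map c e t = t.
Proof.
move=> cid eid; elim: t => //= [x|s -> t ->|a t ->] //; first by rewrite eid.
by rewrite cid.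
Qed.

End TermMapFunctoriality.

Section Functoriality.
Variables (A B C : comPzRingType).
Variables (h : {rmorphism A -> B}) (k : {rmorphism B -> C}) (l : {rmorphism A -> C}).

Lemma per_map_zmod_morphism : zmod_morphism (per_map h).
Proof.
move=> x y; have [s ->] := pclass_surj x; have [t ->] := pclass_surj y.
rewrite [in LHS]poppE [in RHS]poppE -pclassD !per_mapE.
exact: pclassD.
Qed.

Lemma per_map_monoid_morphism : monoid_morphism (per_map h).
Proof.
split=> [|x y]; first exact: per_mapE 1%T.
have [s ->] := pclass_surj x; have [t ->] := pclass_surj y.
by rewrite -pclassM !per_mapE -pclassM.
Qed.

HB.instance Definition _ :=
  GRing.isZmodMorphism.Build (ell_per A) (ell_per B) (per_map h) per_map_zmod_morphism.
HB.instance Definition _ :=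
  GRing.isMonoidMorphism.Build (ell_per A) (ell_per B) (per_map h) per_map_monoid_morphism.

Lemma plus_mapZ a x : plus_map h (a *: x) = ell_map h a *: plus_map h x.
Proof. by have [t ->] := mclass_surj x; rewrite -mclassZ !plus_mapE mclassZ. Qed.

Lemma plus_mapD : {morph plus_map h : x y / x + y}.
Proof.
move=> x y; have [s ->] := mclass_surj x; have [t ->] := mclass_surj y.
by rewrite -mclassD !plus_mapE mclassD.
Qed.

Lemma plus_mapB : zmod_morphism (plus_map h).
Proof.
by move=> x y; rewrite -scaleN1r plus_mapD plus_mapZ rmorphN1 scaleN1r.
Qed.

HB.instance Definition _ :=
  GRing.isZmodMorphism.Build (ell_plus A) (ell_plus B) (plus_map h) plus_mapB.

Lemma ell_map_comp x : l =1 k \o h -> ell_map l x = ell_map k (ell_map h x).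
Proof.
move=> e; have [t ->] := pclass_surj x; rewrite !ell_mapE.
by congr pclass; apply: term_map_comp => -[a|a|a|] //=; rewrite e.
Qed.

Lemma per_map_comp x : l =1 k \o h -> per_map l x = per_map k (per_map h x).
Proof.
move=> e; have [t ->] := pclass_surj x; rewrite !per_mapE.
by congr pclass; apply: term_map_comp => -[a|a||] //=; rewrite e.
Qed.

Lemma plus_map_comp x : l =1 k \o h -> plus_map l x = plus_map k (plus_map h x).
Proof.
move=> e; have [t ->] := mclass_surj x; rewrite !plus_mapE.
congr mclass; apply: mterm_map_comp => [a|[a|i]] //=; last by rewrite e.
exact: ell_map_comp.
Qed.

Variable (c : {rmorphism A -> A}).

Lemma ell_map_id x : c =1 id -> ell_map c x = x.
Proof.
move=> e; have [t ->] := pclass_surj x; rewrite !ell_mapE.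
by congr pclass; apply: term_map_id => -[a|a|a|] //=; rewrite e.
Qed.

Lemma per_map_id x : c =1 id -> per_map c x = x.
Proof.
move=> e; have [t ->] := pclass_surj x; rewrite !per_mapE.
by congr pclass; apply: term_map_id => -[a|a||] //=; rewrite e.
Qed.

Lemma plus_map_id x : c =1 id -> plus_map c x = x.
Proof.
move=> e; have [t ->] := mclass_surj x; rewrite !plus_mapE.
congr mclass; apply: mterm_map_id => [a|[a|i]] //=; last by rewrite e.
exact: ell_map_id.
Qed.

End Functoriality.

Section Cancel.
Variables (A B : comPzRingType) (h : {rmorphism A -> B}) (k : {rmorphism B -> A}).
Hypothesis hK : cancel h k.
Let idA : {rmorphism A -> A} := idfun.
Let idE : idA =1 k \o h. Proof. by move=> x; rewrite /= hK. Qed.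

Lemma ell_mapK : cancel (ell_map h) (ell_map k).
Proof. by move=> x; rewrite -(ell_map_comp x idE) ell_map_id. Qed.

Lemma per_mapK : cancel (per_map h) (per_map k).
Proof. by move=> x; rewrite -(per_map_comp x idE) per_map_id. Qed.

Lemma plus_mapK : cancel (plus_map h) (plus_map k).
Proof. by move=> x; rewrite -(plus_map_comp x idE) plus_map_id. Qed.

End Cancel.

Section Coequalizers.
Variable ungraded : bool.
Implicit Types A B P Q : ft_alg ungraded.

Inductive pair_span (L : ft_alg ungraded -> zmodType)
    (Lmap : forall A B, gr_alg_hom A B -> L A -> L B)
    A P (h : gr_alg_hom P A) : L P -> Prop :=
  | pair_span0 : pair_span Lmap h 0
  | pair_spanB x y of pair_span Lmap h x & pair_span Lmap h y :
      pair_span Lmap h (x - y)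
  | pair_span_pair Q (i : gr_alg_hom P Q) (d0 d1 : gr_alg_hom Q P) w of
      refl_pair h i d0 d1 : pair_span Lmap h (Lmap Q P d0 w - Lmap Q P d1 w).

Section PairSpan.
Variables (L : ft_alg ungraded -> zmodType).
Variable (Lmap : forall A B, gr_alg_hom A B -> L A -> L B).
Variables (A P : ft_alg ungraded) (h : gr_alg_hom P A).
Local Notation N := (pair_span Lmap h).

Lemma pair_spanN x : N x -> N (- x).
Proof. by move=> nx; rewrite -sub0r; apply: pair_spanB nx; apply: pair_span0. Qed.

Lemma pair_spanD x y : N x -> N y -> N (x + y).
Proof. by move=> nx /pair_spanN ny; rewrite -[y]opprK; apply: pair_spanB. Qed.

Definition coeq x y : Prop := N (x - y).

Lemma coeq_refl x : coeq x x.
Proof. by rewrite /coeq subrr; apply: pair_span0. Qed.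

Lemma coeq_sym x y : coeq x y -> coeq y x.
Proof. by move=> /pair_spanN; rewrite opprB. Qed.

Lemma coeq_trans x y z : coeq x y -> coeq y z -> coeq x z.
Proof. by move=> xy yz; rewrite /coeq -(subrKA y); apply: pair_spanD. Qed.

Lemma coeqD x x' y y' : coeq x x' -> coeq y y' -> coeq (x + y) (x' + y').
Proof. by move=> xx' yy'; rewrite /coeq opprD addrACA; apply: pair_spanD. Qed.

End PairSpan.

Section RingPairSpan.
Variables (L : ft_alg ungraded -> comPzRingType).
Variable (Lmap : forall A B, gr_alg_hom A B -> {rmorphism L A -> L B}).
Hypothesis Lmap_id : forall A B (h : gr_alg_hom A B) (k : gr_alg_hom B A),
  (forall x, k (h x) = x) -> forall w, Lmap k (Lmap h w) = w.
Variables (A P : ft_alg ungraded) (h : gr_alg_hom P A).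
Local Notation N := (@pair_span (fun A => L A) (fun A B h => Lmap h) A P h).
Local Notation E := (@coeq (fun A => L A) (fun A B h => Lmap h) A P h).

Lemma pair_spanM a x : N x -> N (a * x).
Proof.
elim=> [|{}x y _ nx _ ny|Q i d0 d1 w r].
- by rewrite mulr0; apply: pair_span0.
- by rewrite mulrBr; apply: pair_spanB.
- rewrite mulrBr -{1}(Lmap_id (rp_id0 r) a) -{2}(Lmap_id (rp_id1 r) a) -!rmorphM.
  exact: pair_span_pair r.
Qed.

Lemma coeqM x x' y y' : E x x' -> E y y' -> E (x * y) (x' * y').
Proof.
move=> xx' yy'; apply: (coeq_trans (y := x' * y)).
  by rewrite /coeq -mulrBl mulrC; apply: pair_spanM.
by rewrite /coeq -mulrBr; apply: pair_spanM.
Qed.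

End RingPairSpan.

End Coequalizers.

Definition ell_hom (A B : comPzRingType) (h : {rmorphism A -> B}) :
  {rmorphism ell A -> ell B} := ell_map h.
Definition per_hom (A B : comPzRingType) (h : {rmorphism A -> B}) :
  {rmorphism ell_per A -> ell_per B} := per_map h.
Definition plus_hom (A B : comPzRingType) (h : {rmorphism A -> B}) :
  {additive ell_plus A -> ell_plus B} := plus_map h.

Section RelationLifts.
Variables (A B : comPzRingType) (h : {rmorphism A -> B}) (sec : B -> A).
Hypothesis secK : forall b, h (sec b) = b.

Local Ltac lift r := do 2 eexists; split; [exact r | | ].

Lemma ell_rel_lift s t : ell_rel s t -> exists s' t', [/\ ell_rel s' t',
  term_map (ell_gen_map h) s' = s & term_map (ell_gen_map h) t' = t].
Proof.
case=> [a b|a b|a b|a b c|a b|a b|a|a|a b|a b|a|]; [lift (ell_phiD (sec a) (sec b))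
  | lift (ell_deltaD (sec a) (sec b))
  | lift (ell_qD (sec a) (sec b))
  | lift (ell_delta3 (sec a) (sec b) (sec c))
  | lift (ell_phiM (sec a) (sec b))
  | lift (ell_qM (sec a) (sec b))
  | lift (ell_delta_sq (sec a))
  | lift (ell_q_sq (sec a))
  | lift (ell_delta_phi (sec a) (sec b))
  | lift (ell_delta_q (sec a) (sec b))
  | lift (ell_u_delta (sec a))
  | lift (ell_phi1 A) ];
  by rewrite /= ?(rmorphD, rmorphM, rmorphXn, rmorph1) /= ?secK.
Qed.

Lemma per_rel_lift s t : per_rel s t -> exists s' t', [/\ per_rel s' t',
  term_map (per_gen_map h) s' = s & term_map (per_gen_map h) t' = t].
Proof.
case=> [a b|a b|a b|a b|a||]; [lift (per_phiD (sec a) (sec b))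
  | lift (per_qD (sec a) (sec b))
  | lift (per_phiM (sec a) (sec b))
  | lift (per_qM (sec a) (sec b))
  | lift (per_q_sq (sec a))
  | lift (per_uv A)
  | lift (per_phi1 A) ];
  by rewrite /= ?(rmorphD, rmorphM, rmorph1) /= ?secK.
Qed.

Lemma plus_rel_lift s t : plus_rel s t -> exists s' t', [/\ plus_rel s' t',
  mterm_map (ell_map h) (plus_gen_map h) s' = s &
  mterm_map (ell_map h) (plus_gen_map h) t' = t].
Proof.
have Ed a : ell_map h (ell_delta a) = ell_delta (h a) by exact: ell_mapE.
have Ep a : ell_map h (ell_phi a) = ell_phi (h a) by exact: ell_mapE.
have Eq a : ell_map h (ell_q a) = ell_q (h a) by exact: ell_mapE.
have Eu : ell_map h (ell_u A) = ell_u B by exact: ell_mapE.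
case=> [a b|a b|a b|a b|a b c|a|a i|i|]; [lift (plus_gammaD (sec a) (sec b))
  | lift (plus_phi (sec a) (sec b))
  | lift (plus_q (sec a) (sec b))
  | lift (plus_delta (sec a) (sec b))
  | lift (plus_delta3 (sec a) (sec b) (sec c))
  | lift (plus_u_gamma (sec a))
  | lift (plus_delta_v (sec a) i)
  | lift (plus_u_v A i)
  | lift (plus_gamma1 A) ];
  by rewrite /= ?(Ed, Ep, Eq, Eu) ?(rmorphD, rmorphM, rmorphXn, rmorph1) /= ?secK.
Qed.

End RelationLifts.

Section Kernels.
Variables (ungraded : bool) (n : nat -> nat) (hn : admissible ungraded n).
Variables (A : ft_alg ungraded) (h : gr_alg_hom (free_ft hn) A).
Hypothesis hsurj : forall y, exists x, h x = y.
Local Notation P := (free_ft hn).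
Local Notation ellE :=
  (@coeq ungraded (fun A => ell A) (fun A B h => ell_hom h) A P h).
Local Notation perE :=
  (@coeq ungraded (fun A => ell_per A) (fun A B h => per_hom h) A P h).
Local Notation plusE :=
  (@coeq ungraded (fun A => ell_plus A) (fun A B h => plus_hom h) A P h).

Local Notation ellN :=
  (@pair_span ungraded (fun A => ell A) (fun A B h => ell_hom h) A P h).
Local Notation plusN :=
  (@pair_span ungraded (fun A => ell_plus A) (fun A B h => plus_hom h) A P h).

Lemma section_ex : exists s : A -> P, forall y, h (s y) = y.
Proof. by have [s hs] := choice hsurj; exists s. Qed.

Lemma ell_map_surj (y : ell A) : exists x, ell_map h x = y.
Proof.
have [s hs] := section_ex.
by apply: (presented_map_surj (@ell_rel_map _ _ h) (sec := ell_gen_map s)) => -[a|a|a|] /=;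
  rewrite ?hs.
Qed.

Lemma ell_map_ker (x y : ell P) : ell_map h x = ell_map h y -> ellE x y.
Proof.
have [s hs] := section_ex.
apply: (presented_map_ker (@ell_rel_map _ _ h) (sec := ell_gen_map s)).
- by case=> [a|a|a|] /=; rewrite ?hs.
- exact: ell_rel_lift hs.
- exact: coeq_refl.
- exact: coeq_sym.
- exact: coeq_trans.
- exact: coeqD.
- by apply: coeqM => B C f k; apply: ell_mapK.
- have gen (c : forall B : Type, B -> ell_gen B) p p' :
      (forall (B C : ft_alg ungraded) (f : gr_alg_hom B C) b,
         ell_map f (pgen _ (c B b)) = pgen _ (c C (f b))) ->
      h p = h p' -> ellE (pgen _ (c P p)) (pgen _ (c P p')).
    move=> cE /free_refl_pair[Q [i [d0 [d1 [q [r <- <-]]]]]].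
    by rewrite -!cE; apply: pair_span_pair r.
  case=> [p|p|p|] [p'|p'|p'|] //=; last by move=> _; apply: coeq_refl.
  + by case; apply: (gen Delta) => B C f b; exact: ell_mapE.
  + by case; apply: (gen Phi) => B C f b; exact: ell_mapE.
  + by case; apply: (gen Qop) => B C f b; exact: ell_mapE.
Qed.

Lemma per_map_surj (y : ell_per A) : exists x, per_map h x = y.
Proof.
have [s hs] := section_ex.
by apply: (presented_map_surj (@per_rel_map _ _ h) (sec := per_gen_map s)) => -[a|a||] /=;
  rewrite ?hs.
Qed.

Lemma per_map_ker (x y : ell_per P) : per_map h x = per_map h y -> perE x y.
Proof.
have [s hs] := section_ex.
apply: (presented_map_ker (@per_rel_map _ _ h) (sec := per_gen_map s)).
- by case=> [a|a||] /=; rewrite ?hs.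
- exact: per_rel_lift hs.
- exact: coeq_refl.
- exact: coeq_sym.
- exact: coeq_trans.
- exact: coeqD.
- by apply: coeqM => B C f k; apply: per_mapK.
- have gen (c : forall B : Type, B -> per_gen B) p p' :
      (forall (B C : ft_alg ungraded) (f : gr_alg_hom B C) b,
         per_map f (pgen _ (c B b)) = pgen _ (c C (f b))) ->
      h p = h p' -> perE (pgen _ (c P p)) (pgen _ (c P p')).
    move=> cE /free_refl_pair[Q [i [d0 [d1 [q [r <- <-]]]]]].
    by rewrite -!cE; apply: pair_span_pair r.
  case=> [p|p||] [p'|p'||] //=; try by move=> _; apply: coeq_refl.
  + by case; apply: (gen PPhi) => B C f b; exact: per_mapE.
  + by case; apply: (gen PQop) => B C f b; exact: per_mapE.
Qed.

Lemma plus_map_surj (y : ell_plus A) : exists x, plus_map h x = y.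
Proof.
have [s hs] := section_ex.
apply: (presented_mod_map_surj (@plus_rel_map _ _ h) ell_map_surj (sec := plus_gen_map s)).
by case=> [a|i] /=; rewrite ?hs.
Qed.

Lemma pair_spanZr a x : plusN x -> plusN (a *: x).
Proof.
elim=> [|{}x y _ nx _ ny|Q i d0 d1 w r].
- by rewrite scaler0; apply: pair_span0.
- by rewrite scalerBr; apply: pair_spanB.
- rewrite scalerBr -{1}(ell_mapK (rp_id0 r) a) -{2}(ell_mapK (rp_id1 r) a).
  by rewrite -!plus_mapZ; apply: pair_span_pair r.
Qed.

Lemma pair_spanZl a x : ellN a -> plusN (a *: x).
Proof.
elim=> [|{}a b _ na _ nb|Q i d0 d1 w r].
- by rewrite scale0r; apply: pair_span0.
- by rewrite scalerBl; apply: pair_spanB.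
- rewrite scalerBl -{1}(plus_mapK (rp_id0 r) x) -{2}(plus_mapK (rp_id1 r) x).
  by rewrite -!plus_mapZ; apply: pair_span_pair r.
Qed.

Lemma coeqZ a a' x x' : ell_map h a = ell_map h a' -> plusE x x' ->
  plusE (a *: x) (a' *: x').
Proof.
move=> /ell_map_ker aa' xx'; apply: (coeq_trans (y := a *: x')).
  by rewrite /coeq -scalerBr; apply: pair_spanZr.
by rewrite /coeq -scalerBl; apply: pair_spanZl.
Qed.

Lemma plus_map_ker (x y : ell_plus P) : plus_map h x = plus_map h y -> plusE x y.
Proof.
have [s hs] := section_ex.
apply: (presented_mod_map_ker (@plus_rel_map _ _ h) ell_map_surj (sec := plus_gen_map s)).
- by case=> [a|i] /=; rewrite ?hs.
- exact: plus_rel_lift hs.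
- exact: coeq_refl.
- exact: coeq_sym.
- exact: coeq_trans.
- exact: coeqD.
- exact: coeqZ.
- case=> [p|i] [p'|i'] //=; last by case=> ->; apply: coeq_refl.
  case=> /free_refl_pair[Q [i [d0 [d1 [q [r <- <-]]]]]].
  have E (f : gr_alg_hom Q P) : mgen _ (Gamma (f q)) = plus_hom f (plus_gamma q).
    by apply/esym; exact: plus_mapE.
  by rewrite !E; apply: pair_span_pair r.
Qed.

End Kernels.

(** * Naturality and degrees of products *)

Section ChainMapProducts.
Variables (A B : comPzRingType) (h : {rmorphism A -> B}).
Implicit Types (w : word A) (x y : formal A).

Lemma map_perm_act n (sigma : 'S_n) (s : seq A) :
  perm_act sigma (map h s) = map h (perm_act sigma s).
Proof. by rewrite /perm_act -[RHS]map_comp; apply: eq_map => i /=; apply: nth_rmorph. Qed.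

Lemma shuffle_word_map w w' :
  shuffle_word (word_map h w) (word_map h w') = formal_map h (shuffle_word w w').
Proof.
rewrite /shuffle_word /= !size_map raddf_sum /=; apply: eq_bigr => sigma _.
by rewrite formal_mapU /word_map /= rmorphM -map_perm_act map_cat.
Qed.

Lemma cyclic_shuffle_word_map w w' :
  cyclic_shuffle_word (word_map h w) (word_map h w') =
  formal_map h (cyclic_shuffle_word w w').
Proof.
rewrite /cyclic_shuffle_word /= !size_map raddf_sum /=; apply: eq_bigr => sigma _.
by rewrite formal_mapU /word_map /= rmorph1 -map_perm_act /= map_cat.
Qed.

Lemma bilin_ext_map (f : word A -> word A -> formal A) (g : word B -> word B -> formal B) :
  (forall w w', g (word_map h w) (word_map h w') = formal_map h (f w w')) ->
  forall x y, bilin_ext g (formal_map h x) (formal_map h y) = formal_map h (bilin_ext f x y).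
Proof.
move=> fg x y; rewrite /bilin_ext.
pose f1 := lin_ext (fun k => lin_ext (g k) (formal_map h y)) \o formal_map h.
pose g1 := formal_map h \o lin_ext (fun k => lin_ext (f k) y).
suff: f1 =1 g1 by apply.
apply: additive_ext => w; rewrite /f1 /g1 /= formal_mapU !lin_extU.
pose f2 := lin_ext (g (word_map h w)) \o formal_map h.
pose g2 := formal_map h \o lin_ext (f w).
suff: f2 =1 g2 by apply.
by apply: additive_ext => w'; rewrite /f2 /g2 /= formal_mapU !lin_extU.
Qed.

Lemma shuffle_prod_map x y :
  shuffle_prod (formal_map h x) (formal_map h y) = formal_map h (shuffle_prod x y).
Proof. exact: bilin_ext_map shuffle_word_map x y. Qed.

Lemma cyclic_shuffle_prod_map x y :
  cyclic_shuffle_prod (formal_map h x) (formal_map h y) =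
  formal_map h (cyclic_shuffle_prod x y).
Proof. exact: bilin_ext_map cyclic_shuffle_word_map x y. Qed.

End ChainMapProducts.

Section BilinExt0.
Variables (K L : choiceType) (V : lmodType 'F_2) (f : K -> L -> V).

Lemma bilin_ext0l y : bilin_ext f 0 y = 0.
Proof. exact: (raddf0 (lin_ext (fun k => lin_ext (f k) y))). Qed.

Lemma bilin_ext0r x : bilin_ext f x 0 = 0.
Proof.
rewrite /bilin_ext /lin_ext big1 // => k _.
by rewrite [X in _ *: X](raddf0 (lin_ext (f k))) scaler0.
Qed.

End BilinExt0.

Definition bounded_below (A : comPzRingType) (c : cchain A) (N : nat) : Prop :=
  forall i : int, i < - N%:Z -> c i = 0.

Lemma cyc_total_bounded (A : gr_alg nat) v (c : cchain A) :
  cyc_total v c -> exists N, bounded_below c N.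
Proof.
elim=> [|d c1 c2 _ h1 _ [N hN]]; first by exists 0%N.
exists (maxn N `|d.1|%N) => i iN; have -> : (c1 + c2) i = c1 i.
  by apply: etrans (congr1 (fun x => c1 i + x) (hN i _)) _; [lia | exact: addr0].
have := h1 i; case: (u_range v i) => // -[sz _].
by rewrite [LHS]malg_F2E big1_seq //= => w /sz e; exfalso; lia.
Qed.

Lemma representsB (A : gr_alg nat) v (c c' : cchain A) (x y : HC A v) :
  represents c x -> represents c' y -> represents (c - c') (x - y).
Proof.
move=> [zc ->] [zc' ->]; have zB := is_cycleB zc zc'; split=> //.
rewrite /hc_class -[LHS]raddfB; congr (\pi_(HC A v) _)%qT; apply: val_inj.
have V b : is_cycle v b -> cycle_val (insubd (0 : cycle_type A v) b) = b.
  by move=> zb; apply: insubdK; apply/asboolP.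
exact: etrans (cycle_valB _ _) (etrans
  (f_equal2 (fun a b => a - b) (V _ zc) (V _ zc')) (esym (V _ zB))).
Qed.

Section CycMul.
Variables (A B : gr_alg nat) (h : gr_alg_hom A B).

Lemma bounded_below_map (c : cchain A) N :
  bounded_below c N -> bounded_below (cchain_map h c) N.
Proof. by move=> hc i /hc ci; rewrite /cchain_map ci raddf0. Qed.

Lemma cyc_mulE (C : comPzRingType) v (c c' : cchain C) N N' k :
  bounded_below c N -> bounded_below c' N' ->
  cyc_mul v c c' k = if u_range v k then
    \sum_(i <- [fset i%:Z - N%:Z | i in iota 0 (N + N' + `|k|).+1]%fset)
      (shuffle_prod (c i) (c' (k - i)) + cyclic_shuffle_prod (c i) (c' (k - 1 - i)))
  else 0.
Proof.
move=> hc hc'; rewrite /cyc_mul; case: (u_range v k) => //.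
apply: fsbigTE => i /imfsetP iN.
have [lt|ge] : i < - N%:Z \/ - N%:Z <= i :> int by lia.
  by rewrite hc // /shuffle_prod /cyclic_shuffle_prod !bilin_ext0l addr0.
have [le|big] : i <= N'%:Z + `|k| \/ N'%:Z + `|k| < i :> int by lia.
  case: iN; exists `|(i + N%:Z)%R|%N; last lia.
  have im : `|(i + N%:Z)%R|%N \in iota 0 (N + N' + `|k|).+1 by rewrite mem_iota; lia.
  exact: im.
rewrite (hc' (k - i)) ?(hc' (k - 1 - i)); [|lia|lia].
by rewrite /shuffle_prod /cyclic_shuffle_prod !bilin_ext0r addr0.
Qed.

Lemma cyc_mul_map v v' (c c' : cchain A) : cyc_total v c -> cyc_total v' c' ->
  cyc_mul v' (cchain_map h c) (cchain_map h c') = cchain_map h (cyc_mul v' c c').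
Proof.
move=> /cyc_total_bounded[N hN] /cyc_total_bounded[N' hN']; apply/funext => k.
rewrite [RHS]/cchain_map (cyc_mulE _ _ hN hN').
rewrite (cyc_mulE _ _ (bounded_below_map hN) (bounded_below_map hN')).
case: (u_range v' k); last by rewrite raddf0.
rewrite raddf_sum; apply: eq_bigr => i _.
rewrite [RHS]raddfD. by congr (_ + _); rewrite ?shuffle_prod_map ?cyclic_shuffle_prod_map.
Qed.

Lemma hc_mul_map v v' (x : HC A v) (y : HC A v') z z' :
  hc_mul x y z -> hc_mul (hc_map h x) (hc_map h y) z' -> z' = hc_map h z.
Proof.
have [c cx] := represents_ex x; have [c' cy] := represents_ex y.
move=> /(_ _ _ cx cy) cz /(_ _ _ (hc_mapE h cx) (hc_mapE h cy)).
case: cx cy => -[tc _] _ [[tc' _] _].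
rewrite (cyc_mul_map tc tc') => rz'.
exact: represents_unique rz' (hc_mapE h cz).
Qed.

Lemma hc_mapB v : zmod_morphism (@hc_map v A B h).
Proof.
move=> x y; have [c cx] := represents_ex x; have [c' cy] := represents_ex y.
have := hc_mapE h (representsB cx cy); rewrite cchain_mapB.
by move/represents_unique; apply; apply: representsB; apply: hc_mapE.
Qed.

HB.instance Definition _ v :=
  GRing.isZmodMorphism.Build (HC A v) (HC B v) (@hc_map v A B h) (@hc_mapB v).

End CycMul.

Section SupportIn.
Variables (K : choiceType) (Q : K -> Prop).
Implicit Types x y : {malg 'F_2[K]}.

Definition supp_in x : Prop := forall k, k \in msupp x -> Q k.

Lemma supp_in0 : supp_in 0.
Proof. by move=> k; rewrite msupp0. Qed.

Lemma supp_inD x y : supp_in x -> supp_in y -> supp_in (x + y).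
Proof. by move=> hx hy k /(fsubsetP (msuppD_le _ _))/fsetUP[/hx|/hy]. Qed.

Lemma supp_inN x : supp_in x -> supp_in (- x).
Proof. by move=> hx k; rewrite msuppN; apply: hx. Qed.

Lemma supp_inZ c x : supp_in x -> supp_in (c *: x).
Proof. by move=> hx k /(fsubsetP (msuppZ_le _ _))/hx. Qed.

Lemma supp_in_sum (J : Type) (r : seq J) (D : pred J) (F : J -> {malg 'F_2[K]}) :
  (forall j, D j -> supp_in (F j)) -> supp_in (\sum_(j <- r | D j) F j).
Proof. by move=> hF; elim/big_ind: _ => //; [exact: supp_in0 | exact: supp_inD]. Qed.

Lemma supp_inU k : Q k -> supp_in << k >>.
Proof. by move=> Qk k' /(fsubsetP msuppU_le)/fset1P ->. Qed.

Lemma supp_in_bilin (M N : choiceType) (f : M -> N -> {malg 'F_2[K]})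
    (x : {malg 'F_2[M]}) (y : {malg 'F_2[N]}) :
  (forall k l, k \in msupp x -> l \in msupp y -> supp_in (f k l)) ->
  supp_in (bilin_ext f x y).
Proof.
move=> hf; rewrite /bilin_ext /lin_ext big_seq; apply: supp_in_sum => k kx.
rewrite big_seq; apply/supp_inZ/supp_in_sum => l ly; exact/supp_inZ/hf.
Qed.

End SupportIn.

Section HomogeneousWords.
Variable A : gr_alg nat.

Lemma Forall2_nth (r : seq nat) (s : seq A) : List.Forall2 (@ga_piece _ A) r s ->
  size r = size s /\ forall i, ga_piece (nth 0%N r i) s`_i.
Proof.
elim=> [|n a r' s' pa _ [sz IH]].
  by split=> // i; rewrite !nth_nil; apply: (grading0 (ga_grading A)).
by split=> [|[|i]] /=; rewrite ?sz //; apply: IH.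
Qed.

Lemma perm_act_hom n (sigma : 'S_n) (r : seq nat) (s : seq A) :
  size s = n -> List.Forall2 (@ga_piece _ A) r s ->
  exists2 r', List.Forall2 (@ga_piece _ A) r' (perm_act sigma s) & sumn r' = sumn r.
Proof.
move=> szs /Forall2_nth[sz pn].
exists [seq nth 0%N r ((sigma^-1)%g i) | i <- enum 'I_n].
  rewrite /perm_act; elim: (enum 'I_n) => [|i e IH] /=; first exact: List.Forall2_nil.
  exact: List.Forall2_cons.
rewrite [LHS]sumnE big_map big_enum /= sumnE (big_nth 0%N) big_mkord sz szs.
by rewrite [RHS](reindex_perm (sigma^-1)%g).
Qed.

Lemma size_perm_act n (sigma : 'S_n) (s : seq A) : size (perm_act sigma s) = n.
Proof. by rewrite size_map size_enum_ord. Qed.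

Lemma Forall2_cat r1 r2 (s1 s2 : seq A) : List.Forall2 (@ga_piece _ A) r1 s1 ->
  List.Forall2 (@ga_piece _ A) r2 s2 -> List.Forall2 (@ga_piece _ A) (r1 ++ r2) (s1 ++ s2).
Proof. by elim=> //= *; apply: List.Forall2_cons => //; auto. Qed.

Definition graded_word (n s : int) (w : word A) : Prop :=
  (size w.2)%:Z = n /\ hom_word s w.

Lemma shuffle_word_hom n s n' s' w w' : graded_word n s w -> graded_word n' s' w' ->
  supp_in (graded_word (n + n') (s + s')) (shuffle_word w w').
Proof.
move=> [sz [s0 [r [p0 pr <-]]]] [sz' [s0' [r' [p0' pr' <-]]]].
rewrite /shuffle_word; apply: supp_in_sum => sigma _; apply: supp_inU.
split; first by rewrite /= size_perm_act; lia.
have [q pq eq] := perm_act_hom sigma (size_cat _ _) (Forall2_cat pr pr').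
exists (s0 + s0')%N, q; split=> //=; first exact: ga_pieceM.
by rewrite eq sumn_cat; lia.
Qed.

Lemma cyclic_shuffle_word_hom n s n' s' w w' :
  graded_word n s w -> graded_word n' s' w' ->
  supp_in (graded_word (n + n' + 2) (s + s')) (cyclic_shuffle_word w w').
Proof.
move=> [sz [s0 [r [p0 pr <-]]]] [sz' [s0' [r' [p0' pr' <-]]]].
rewrite /cyclic_shuffle_word; apply: supp_in_sum => sigma _; apply: supp_inU.
split; first by rewrite /= size_perm_act; lia.
have [q pq eq] := perm_act_hom (sigma^-1)%g (size_cat (w.1 :: w.2) (w'.1 :: w'.2))
  (Forall2_cat (List.Forall2_cons _ _ p0 pr) (List.Forall2_cons _ _ p0' pr')).
exists 0%N, q; split=> //=; first exact: ga_piece1.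
by rewrite eq /= sumn_cat /=; lia.
Qed.

End HomogeneousWords.

Section GradedChains.
Variable A : gr_alg nat.
Implicit Types (c : cchain A) (d : int * int) (v : theory).

(* Unlike [cyc_hom], this asks every word to be homogeneous, not only up to
   [null]: products of such chains are again homogeneous without a proof that the
   shuffle products preserve [null]. *)
Definition graded_chain v d c : Prop := forall i,
  if u_range v i then supp_in (graded_word (d.1 + i *+ 2) (d.1 + d.2)) (c i)
  else c i = 0.

Lemma graded_chain_hom v d c : graded_chain v d c -> cyc_hom v d c.
Proof.
move=> gc i; have := gc i; case: (u_range v i) => // hi.
split=> [w /hi[]//|]; exists (c i); split=> [w /hi[]//|].
by rewrite subrr; apply: null_zero.
Qed.

Lemma graded_chain_supp v d c i : graded_chain v d c ->
  supp_in (graded_word (d.1 + i *+ 2) (d.1 + d.2)) (c i).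
Proof.
by move=> /(_ i); case: (u_range v i) => // ->; apply: supp_in0.
Qed.

Lemma graded_chain_mul v v' d d' c c' : graded_chain v d c -> graded_chain v' d' c' ->
  graded_chain v' (d + d') (cyc_mul v' c c').
Proof.
move=> gc gc' k; rewrite /cyc_mul; case: (u_range v' k) => //.
apply: supp_in_sum => i _; rewrite /shuffle_prod /cyclic_shuffle_prod.
apply: supp_inD; apply: supp_in_bilin => w w'.
  move=> /(graded_chain_supp gc) hw /(graded_chain_supp gc') hw'.
  have := shuffle_word_hom hw hw'.
  have -> : d.1 + i *+ 2 + (d'.1 + (k - i) *+ 2) = (d + d').1 + k *+ 2 by rewrite /=; lia.
  by have -> : d.1 + d.2 + (d'.1 + d'.2) = (d + d').1 + (d + d').2 by rewrite /=; lia.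
move=> /(graded_chain_supp gc) hw /(graded_chain_supp gc') hw'.
have := cyclic_shuffle_word_hom hw hw'.
have -> : d.1 + i *+ 2 + (d'.1 + (k - 1 - i) *+ 2) + 2 = (d + d').1 + k *+ 2
  by rewrite /=; lia.
by have -> : d.1 + d.2 + (d'.1 + d'.2) = (d + d').1 + (d + d').2 by rewrite /=; lia.
Qed.

Lemma graded_chain0 v d : graded_chain v d 0.
Proof. by move=> i; case: (u_range v i) => //; apply: supp_in0. Qed.

Lemma graded_chainB v d c c' : graded_chain v d c -> graded_chain v d c' ->
  graded_chain v d (c - c').
Proof.
move=> gc gc' i; have := gc i; have := gc' i; rewrite cyc_subE.
by case: (u_range v i) => [h' h|-> ->]; [exact: supp_inD h (supp_inN h') | exact: subrr].
Qed.

Lemma graded_chainD v d c c' : graded_chain v d c -> graded_chain v d c' ->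
  graded_chain v d (c + c').
Proof.
move=> gc gc'; rewrite -[c']opprK; apply: graded_chainB => //.
by rewrite -sub0r; apply: graded_chainB => //; apply: graded_chain0.
Qed.

Lemma graded_chain_single v d i (w : word A) : u_range v i ->
  (size w.2)%:Z = d.1 + i *+ 2 -> hom_word (d.1 + d.2) w ->
  graded_chain v d (cyc_single i w).
Proof.
move=> vi sz hw j; rewrite /cyc_single; case: eqP => [->|_].
  by rewrite vi; apply: supp_inU.
by case: (u_range v j) => //; apply: supp_in0.
Qed.

Definition graded_class v d (x : HC A v) : Prop :=
  exists2 c, represents c x & graded_chain v d c.

Lemma graded_class_piece v d (x : HC A v) (G : zmodType) (tdeg : int * int -> G) :
  graded_class d x -> hc_piece tdeg (tdeg d) x.
Proof.
move=> [c cx gc]; exists c; split=> //; rewrite -[c]addr0.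
by apply: cyc_sumD (graded_chain_hom gc) _ => //; apply: cyc_sum0.
Qed.

Lemma graded_classB v d (x y : HC A v) : graded_class d x -> graded_class d y ->
  graded_class d (x - y).
Proof.
move=> [c cx gc] [c' cy gc']; exists (c - c'); first exact: representsB.
exact: graded_chainB.
Qed.

Lemma graded_class0 v d : graded_class d (0 : HC A v).
Proof.
have [c cx] := represents_ex (0 : HC A v).
by exists (c - c); [rewrite -(subrr 0); apply: representsB | rewrite subrr; apply: graded_chain0].
Qed.

Lemma graded_classD v d (x y : HC A v) : graded_class d x -> graded_class d y ->
  graded_class d (x + y).
Proof.
move=> gx gy; rewrite -[y]opprK; apply: graded_classB => //.
by rewrite -sub0r; apply: graded_classB => //; apply: graded_class0.
Qed.

Lemma graded_class_mul v v' d d' (x : HC A v) (y : HC A v') z :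
  hc_mul x y z -> graded_class d x -> graded_class d' y -> graded_class (d + d') z.
Proof.
move=> xyz [c cx gc] [c' cy gc']; exists (cyc_mul v' c c'); first exact: xyz.
exact: graded_chain_mul gc gc'.
Qed.

Lemma hom_word0 : hom_word 0 ((1, [::]) : word A).
Proof. by exists 0%N, [::]; split=> //=; exact: ga_piece1. Qed.

Lemma hom_word_head s (a : A) : ga_piece s a -> hom_word s%:Z (a, [::]).
Proof. by move=> pa; exists s, [::]; split=> //=; rewrite addn0. Qed.

Lemma hom_word_cons s t (a b : A) l : ga_piece s a ->
  hom_word t (b, l) -> hom_word (t + s%:Z) (b, a :: l).
Proof.
move=> pa [s0 [r [p0 pr <-]]]; exists s0, (s :: r); split=> //=; last lia.
exact: List.Forall2_cons.
Qed.

Lemma hc_alg_hom_graded X (R : term X -> term X -> Prop) v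
    (gdeg : X -> int * int -> Prop) (f : presented R -> HC A v) d x :
  is_hc_alg_hom f -> u_range v 0 ->
  (forall x d, gdeg x d -> graded_class d (f (pgen R x))) ->
  pterm_hom gdeg d x -> graded_class d (f x).
Proof.
move=> [fD f1 fM] v0 fg; elim=> {d x}.
- by move=> x d /fg.
- have -> : f 0 = 0 by exact: morph0.
  exact: graded_class0.
- exists (cyc_single 0 (1, [::])) => //; apply: graded_chain_single => //.
  exact: hom_word0.
- by move=> d x y _ gx _ gy; rewrite fD; apply: graded_classD.
- by move=> d d' x y _ gx _ gy; apply: graded_class_mul (fM _ _) gx gy.
Qed.

Lemma psi_graded (f : ell A -> HC A Neg) d x : is_psi f -> ell_piece d x ->
  graded_class d (f x).
Proof.
move=> [fh fd fq fp fu]; apply: hc_alg_hom_graded => // {d x} _ _ [s a pa|s a pa|s a pa|].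
- eexists; first exact: fd; apply: graded_chain_single => //=.
  have -> : 1 + (s%:Z - 1) = 0 + s%:Z by lia.
  exact/hom_word_cons/hom_word0.
- eexists; first exact: fp; apply: graded_chainD; apply: graded_chain_single => //=.
    have -> : 0 + s%:Z *+ 2 = (s + s)%N%:Z by lia.
    by apply: hom_word_head; rewrite expr2; apply: ga_pieceM.
  have -> : 0 + s%:Z *+ 2 = 0 + s%:Z + s%:Z by lia.
  by do 2 apply: hom_word_cons => //; apply: hom_word0.
- eexists; first exact: fq; apply: graded_chain_single => //=.
  have -> : 1 + (s%:Z *+ 2 - 1) = s%:Z + s%:Z by lia.
  by apply: hom_word_cons => //; apply: hom_word_head.
- by eexists; first exact: fu; apply: graded_chain_single => //=; apply: hom_word0.
Qed.

Lemma psi_per_graded (f : ell_per A -> HC A Per) d x : is_psi_per f -> per_piece d x ->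
  graded_class d (f x).
Proof.
move=> [fh fq fp fu fv]; apply: hc_alg_hom_graded => // {d x} _ _ [s a pa|s a pa||].
- eexists; first exact: fp; apply: graded_chainD; apply: graded_chain_single => //=.
    have -> : 0 + s%:Z *+ 2 = (s + s)%N%:Z by lia.
    by apply: hom_word_head; rewrite expr2; apply: ga_pieceM.
  have -> : 0 + s%:Z *+ 2 = 0 + s%:Z + s%:Z by lia.
  by do 2 apply: hom_word_cons => //; apply: hom_word0.
- eexists; first exact: fq; apply: graded_chain_single => //=.
  have -> : 1 + (s%:Z *+ 2 - 1) = s%:Z + s%:Z by lia.
  by apply: hom_word_cons => //; apply: hom_word_head.
- by eexists; first exact: fu; apply: graded_chain_single => //=; apply: hom_word0.
- by eexists; first exact: fv; apply: graded_chain_single => //=; apply: hom_word0.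
Qed.

Lemma psi_plus_graded (f : ell A -> HC A Neg) (fp : ell_plus A -> HC A Pos) d x :
  is_psi f -> is_psi_plus f fp -> plus_piece d x -> graded_class d (fp x).
Proof.
move=> fP [fD fM fg fv]; elim=> {d x}.
- move=> _ _ [s a pa|i].
    eexists; first exact: fg; apply: graded_chain_single => //=.
    by rewrite add0r; apply: hom_word_head.
  eexists; first exact: fv; apply: graded_chain_single => /=; [lia|lia|].
  by rewrite subrr; apply: hom_word0.
- move=> d; have -> : fp 0 = 0 by exact: morph0.
  exact: graded_class0.
- by move=> d x y _ gx _ gy; rewrite fD; apply: graded_classD.
- move=> d d' a x pa _ gx; apply: graded_class_mul (fM _ _) _ gx.
  exact: psi_graded.
Qed.

End GradedChains.

(** * Extension from polynomial algebras *)

Section PsiNatural.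
Variables (A B : gr_alg nat) (h : gr_alg_hom A B).

Lemma cchain_map_single i (w : word A) :
  cchain_map h (cyc_single i w) = cyc_single i (word_map h w).
Proof.
apply/funext => j; rewrite /cchain_map /cyc_single.
by case: (j == i); [exact: formal_mapU | exact: raddf0].
Qed.

Lemma hc_alg_hom_natural X Y (R : term X -> term X -> Prop) (S : term Y -> term Y -> Prop)
    v (m : {rmorphism presented R -> presented S})
    (f : presented R -> HC A v) (g : presented S -> HC B v) :
  is_hc_alg_hom f -> is_hc_alg_hom g ->
  (forall x, hc_map h (f (pgen R x)) = g (m (pgen R x))) ->
  forall x, hc_map h (f x) = g (m x).
Proof.
move=> [fD f1 fM] [gD g1 gM] fg x; have [t ->] := pclass_surj x.
elim: t => {x} [x|||s IHs t IHt|s IHs t IHt]; first exact: fg.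
- have f0 : f 0 = 0 by exact: morph0.
  have g0 : g 0 = 0 by exact: morph0.
  by rewrite -[pclass R 0%T]/(0 : presented R) f0 !raddf0 g0.
- rewrite -[pclass R 1%T]/(1 : presented R) rmorph1.
  have := hc_mapE h f1; rewrite cchain_map_single /word_map /= rmorph1.
  by move/represents_unique; apply.
- by rewrite pclassD fD rmorphD gD -IHs -IHt; apply: raddfD.
- rewrite pclassM rmorphM; apply/esym; apply: hc_mul_map (fM _ _) _.
  by rewrite IHs IHt; apply: gM.
Qed.

End PsiNatural.

Definition gr_alg_comp (I : nmodType) (A B C : gr_alg I)
    (k : gr_alg_hom B C) (h : gr_alg_hom A B) : gr_alg_hom A C :=
  GrAlgHom (gah_fun := (k \o h : {rmorphism A -> C}))
    (fun i x px => gah_piece k (gah_piece h px)).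

Section Descent.
Variables (ungraded : bool) (v : theory).
Implicit Types A B : ft_alg ungraded.
Variables (L F : ft_alg ungraded -> zmodType).
Variable Lmap : forall A B, gr_alg_hom A B -> {additive L A -> L B}.
Variable Fmap : forall A B, gr_alg_hom A B -> {additive F A -> F B}.
Variable psi : forall A, L A -> HC A v.
Variable f : forall A, F A -> HC A v.
Hypothesis psiD : forall A, {morph @psi A : x y / x + y}.
Hypothesis fD : forall A, {morph @f A : x y / x + y}.
Hypothesis psi_natural : forall A B (h : gr_alg_hom A B) x,
  hc_map h (psi x) = psi (Lmap h x).
Hypothesis f_natural : forall A B (h : gr_alg_hom A B) x,
  f (Fmap h x) = hc_map h (f x).
Hypothesis f_bij : forall A : ft_alg ungraded, is_polynomial A -> bijective (@f A).
Hypothesis Lmap_comp : forall (A B C : ft_alg ungraded) (h : gr_alg_hom A B)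
  (k : gr_alg_hom B C) (l : gr_alg_hom A C) x, l =1 k \o h ->
  Lmap l x = Lmap k (Lmap h x).
Hypothesis Fmap_comp : forall (A B C : ft_alg ungraded) (h : gr_alg_hom A B)
  (k : gr_alg_hom B C) (l : gr_alg_hom A C) x, l =1 k \o h ->
  Fmap l x = Fmap k (Fmap h x).
Hypothesis Lmap_surj : forall n (hn : admissible ungraded n) A
  (h : gr_alg_hom (free_ft hn) A), (forall y, exists x, h x = y) ->
  forall y, exists x, Lmap h x = y.
Hypothesis Lmap_ker : forall n (hn : admissible ungraded n) A
  (h : gr_alg_hom (free_ft hn) A), (forall y, exists x, h x = y) ->
  forall x y, Lmap h x = Lmap h y -> coeq (fun A B h => Lmap h) h x y.

Lemma f_inj A : is_polynomial A -> injective (@f A).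
Proof. by move=> /f_bij /bij_inj. Qed.

Lemma f_surj A (x : L A) : is_polynomial A -> exists z : F A, f z = psi x.
Proof. by move=> /f_bij[g _ gK]; exists (g (psi x)). Qed.

Lemma pair_span_lift0 (A P : ft_alg ungraded) (h : gr_alg_hom P A) (x : L P) (z : F P) :
  is_polynomial P -> pair_span (fun A B h => Lmap h) h x -> f z = psi x ->
  Fmap h z = 0.
Proof.
move=> pP nx; elim: nx z => [|{}x y _ IHx _ IHy|Q i d0 d1 w r] z fz.
- suff -> : z = 0 by rewrite raddf0.
  by apply: (f_inj pP); rewrite fz (morph0 (@psiD _)) (morph0 (@fD _)).
- have [a fa] := f_surj x pP; have [b fb] := f_surj y pP.
  have -> : z = a - b.
    by apply: (f_inj pP); rewrite fz (morphB (@psiD _)) (morphB (@fD _)) fa fb.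
  by rewrite raddfB (IHx _ fa) (IHy _ fb) subrr.
- have [a fa] := f_surj w (rp_poly r).
  have -> : z = Fmap d0 a - Fmap d1 a.
    apply: (f_inj pP); rewrite fz (morphB (@psiD _)) (morphB (@fD _)).
    by rewrite !f_natural fa !psi_natural.
  rewrite raddfB -!(@Fmap_comp _ _ _ _ _ (gr_alg_comp h d0)) ?subrr //.
  by move=> y; rewrite /= (rp_eq r).
Qed.

Definition lift_rel A (y : L A) (z : F A) : Prop :=
  exists n (hn : admissible ungraded n) (h : gr_alg_hom (free_ft hn) A)
      (x : L (free_ft hn)) (z0 : F (free_ft hn)),
    [/\ Lmap h x = y, f z0 = psi x & Fmap h z0 = z].

Lemma lift_rel_cover n (hn : admissible ungraded n) A (h : gr_alg_hom (free_ft hn) A)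
    (y : L A) (z : F A) :
  (forall y, exists x, h x = y) -> lift_rel y z ->
  exists (x : L (free_ft hn)) (z0 : F (free_ft hn)),
    [/\ Lmap h x = y, f z0 = psi x & Fmap h z0 = z].
Proof.
move=> hsurj [m [hm [k [x [z0 [<- fz0 <-]]]]]].
have [l hl] := free_lift k hsurj; exists (Lmap l x), (Fmap l z0); split.
- by rewrite -(@Lmap_comp _ _ _ _ _ k) // => p; rewrite /= hl.
- by rewrite f_natural fz0 psi_natural.
- by rewrite -(@Fmap_comp _ _ _ _ _ k) // => p; rewrite /= hl.
Qed.

Lemma lift_rel_total A (y : L A) : exists z, lift_rel y z.
Proof.
have [n [hn [h hsurj]]] := free_cover A; have [x hx] := Lmap_surj hsurj y.
have [z0 fz0] := f_surj x (free_is_polynomial n : is_polynomial (free_ft hn)).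
by exists (Fmap h z0), n, hn, h, x, z0.
Qed.

Lemma lift_rel_fun A (y : L A) z z' : lift_rel y z -> lift_rel y z' -> z = z'.
Proof.
have [n [hn [h hsurj]]] := free_cover A.
move=> /(lift_rel_cover hsurj)[x [z0 [<- fz0 <-]]].
move=> /(lift_rel_cover hsurj)[x' [z0' [/esym e fz0' <-]]].
apply/eqP; rewrite -subr_eq0 -raddfB; apply/eqP.
apply: (pair_span_lift0 _ (Lmap_ker hsurj e)); first exact: free_is_polynomial.
by rewrite (morphB (@psiD _)) (morphB (@fD _)) fz0 fz0'.
Qed.

Lemma lift_relB A (y y' : L A) z z' :
  lift_rel y z -> lift_rel y' z' -> lift_rel (y - y') (z - z').
Proof.
have [n [hn [h hsurj]]] := free_cover A.
move=> /(lift_rel_cover hsurj)[x [z0 [<- fz0 <-]]].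
move=> /(lift_rel_cover hsurj)[x' [z0' [<- fz0' <-]]].
exists n, hn, h, (x - x'), (z0 - z0'); rewrite !raddfB; split=> //.
by rewrite (morphB (@psiD _)) (morphB (@fD _)) fz0 fz0'.
Qed.

Lemma lift_rel_map A B (k : gr_alg_hom A B) y z :
  lift_rel y z -> lift_rel (Lmap k y) (Fmap k z).
Proof.
move=> [n [hn [h [x [z0 [<- fz0 <-]]]]]].
exists n, hn, (gr_alg_comp k h), x, z0; split=> //; first exact: Lmap_comp.
exact: Fmap_comp.
Qed.

Lemma lift_rel_psi A (y : L A) z : lift_rel y z -> f z = psi y.
Proof.
by move=> [n [hn [h [x [z0 [<- fz0 <-]]]]]]; rewrite f_natural fz0 psi_natural.
Qed.

Definition descent A (y : L A) : F A := sval (cid (lift_rel_total y)).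

Lemma descentP A (y : L A) : lift_rel y (descent y).
Proof. exact: svalP (cid (lift_rel_total y)). Qed.

Lemma descentE A (y : L A) z : lift_rel y z -> descent y = z.
Proof. exact: lift_rel_fun (descentP y). Qed.

Lemma descent_is_zmod_morphism A : zmod_morphism (@descent A).
Proof. by move=> x y; apply: descentE; apply: lift_relB; apply: descentP. Qed.

HB.instance Definition _ A :=
  GRing.isZmodMorphism.Build (L A) (F A) (@descent A) (@descent_is_zmod_morphism A).

Lemma descent_natural A B (k : gr_alg_hom A B) y :
  descent (Lmap k y) = Fmap k (descent y).
Proof. by apply/descentE/lift_rel_map/descentP. Qed.

Lemma descent_psi A (y : L A) : f (descent y) = psi y.
Proof. exact/lift_rel_psi/descentP. Qed.

End Descent.

Section RingDescent.
Variables (ungraded : bool) (v : theory).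
Implicit Types A B : ft_alg ungraded.
Variables (L F : ft_alg ungraded -> comPzRingType).
Variable Lmap : forall A B, gr_alg_hom A B -> {rmorphism L A -> L B}.
Variable Fmap : forall A B, gr_alg_hom A B -> {rmorphism F A -> F B}.
Variable psi : forall A, L A -> HC A v.
Variable f : forall A, F A -> HC A v.
Hypothesis psi_hom : forall A, is_hc_alg_hom (@psi A).
Hypothesis f_hom : forall A, is_hc_alg_hom (@f A).
Hypothesis psi_natural : forall A B (h : gr_alg_hom A B) x,
  hc_map h (psi x) = psi (Lmap h x).
Hypothesis f_natural : forall A B (h : gr_alg_hom A B) x,
  f (Fmap h x) = hc_map h (f x).
Hypothesis f_bij : forall A, is_polynomial A -> bijective (@f A).
Hypothesis Lmap_comp : forall A B (C : ft_alg ungraded) (h : gr_alg_hom A B)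
  (k : gr_alg_hom B C) (l : gr_alg_hom A C) x, l =1 k \o h ->
  Lmap l x = Lmap k (Lmap h x).
Hypothesis Fmap_comp : forall A B (C : ft_alg ungraded) (h : gr_alg_hom A B)
  (k : gr_alg_hom B C) (l : gr_alg_hom A C) x, l =1 k \o h ->
  Fmap l x = Fmap k (Fmap h x).
Hypothesis Lmap_surj : forall n (hn : admissible ungraded n) A
  (h : gr_alg_hom (free_ft hn) A), (forall y, exists x, h x = y) ->
  forall y, exists x, Lmap h x = y.
Hypothesis Lmap_ker : forall n (hn : admissible ungraded n) A
  (h : gr_alg_hom (free_ft hn) A), (forall y, exists x, h x = y) ->
  forall x y, Lmap h x = Lmap h y ->
  @coeq ungraded (fun A => L A) (fun A B h => Lmap h) A (free_ft hn) h x y.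

Local Notation lifts A := (@lift_rel ungraded v (fun B => L B) (fun B => F B)
  (fun B C h => Lmap h) (fun B C h => Fmap h) psi f A).

Let psiD A : {morph @psi A : x y / x + y} := hcah_add (psi_hom A).
Let fD A : {morph @f A : x y / x + y} := hcah_add (f_hom A).

Lemma lift_rel1 A : lifts A 1 1.
Proof.
have [n [hn [h hsurj]]] := free_cover A.
exists n, hn, h, 1, 1; split; [exact: rmorph1 | | exact: rmorph1].
exact: represents_unique (hcah_one (f_hom _)) (hcah_one (psi_hom _)).
Qed.

Lemma lift_relM A y y' z z' : lifts A y z -> lifts A y' z' -> lifts A (y * y') (z * z').
Proof.
have [n [hn [h hsurj]]] := free_cover A.
have cover := @lift_rel_cover ungraded v (fun A => L A) (fun A => F A)
  (fun A B h => Lmap h) (fun A B h => Fmap h) psi f psi_natural f_natural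
  Lmap_comp Fmap_comp _ _ _ h _ _ hsurj.
move=> /cover[x [z0 [<- fz0 <-]]] /cover[x' [z0' [<- fz0' <-]]].
exists n, hn, h, (x * x'), (z0 * z0'); split; [exact: rmorphM | | exact: rmorphM].
have H : hc_mul (f z0) (f z0') (psi (x * x')).
  by rewrite fz0 fz0'; apply: (hcah_mul (psi_hom _)).
exact: hc_mul_unique (@hcah_mul _ _ _ _ (f_hom _) z0 z0') H.
Qed.

Lemma ring_descent : exists e : forall A, {rmorphism L A -> F A},
  [/\ forall A B (k : gr_alg_hom A B) y, e B (Lmap k y) = Fmap k (e A y),
      forall A y, f (e A y) = psi y &
      forall A y z, lifts A y z -> e A y = z].
Proof.
pose e A : L A -> F A := @descent ungraded v (fun A => L A) (fun A => F A)
  (fun A B h => Lmap h) (fun A B h => Fmap h) psi f f_bij Lmap_surj A.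
have eE A y z : lifts A y z -> e A y = z by apply: descentE.
have eP A y : lifts A y (e A y) by apply: descentP.
have eB A : zmod_morphism (e A) by apply: descent_is_zmod_morphism.
have eM A : monoid_morphism (e A).
  by split=> [|x y]; apply: eE; [apply: lift_rel1 | apply: lift_relM].
exists (fun A => HB.pack_for {rmorphism L A -> F A} (e A)
  (GRing.isZmodMorphism.Build _ _ (e A) (eB A))
  (GRing.isMonoidMorphism.Build _ _ (e A) (eM A))).
split=> [A B k y|A y|] //=; last exact: descent_psi.
exact: (@descent_natural ungraded v (fun A => L A) (fun A => F A)
  (fun A B h => Lmap h) (fun A B h => Fmap h)).
Qed.

End RingDescent.

Section PsiNaturality.
Variables (A B : gr_alg nat) (h : gr_alg_hom A B).

Lemma psi_natural (f : ell A -> HC A Neg) (g : ell B -> HC B Neg) :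
  is_psi f -> is_psi g -> forall x, hc_map h (f x) = g (ell_map h x).
Proof.
move=> [fh fd fq fp fu] [gh gd gq gp gu].
apply: (hc_alg_hom_natural (m := ell_hom h) fh gh) => x.
rewrite [ell_hom h _](_ : _ = pgen _ (ell_gen_map h x)); last exact: ell_mapE.
case: x => [a|a|a|] /=.
- have := hc_mapE h (fd a); rewrite cchain_map_single /word_map /= rmorph1.
  by move/represents_unique; apply; apply: gd.
- have := hc_mapE h (fp a); rewrite cchain_mapD !cchain_map_single /word_map /=.
  by rewrite rmorph1 rmorphXn => /represents_unique; apply; apply: gp.
- have := hc_mapE h (fq a); rewrite cchain_map_single /word_map /=.
  by move/represents_unique; apply; apply: gq.
- have := hc_mapE h fu; rewrite cchain_map_single /word_map /= rmorph1.
  by move/represents_unique; apply; apply: gu.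
Qed.

Lemma psi_per_natural (f : ell_per A -> HC A Per) (g : ell_per B -> HC B Per) :
  is_psi_per f -> is_psi_per g -> forall x, hc_map h (f x) = g (per_map h x).
Proof.
move=> [fh fq fp fu fv] [gh gq gp gu gv].
apply: (hc_alg_hom_natural (m := per_hom h) fh gh) => x.
rewrite [per_hom h _](_ : _ = pgen _ (per_gen_map h x)); last exact: per_mapE.
case: x => [a|a||] /=.
- have := hc_mapE h (fp a); rewrite cchain_mapD !cchain_map_single /word_map /=.
  by rewrite rmorph1 rmorphXn => /represents_unique; apply; apply: gp.
- have := hc_mapE h (fq a); rewrite cchain_map_single /word_map /=.
  by move/represents_unique; apply; apply: gq.
- have := hc_mapE h fu; rewrite cchain_map_single /word_map /= rmorph1.
  by move/represents_unique; apply; apply: gu.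
- have := hc_mapE h fv; rewrite cchain_map_single /word_map /= rmorph1.
  by move/represents_unique; apply; apply: gv.
Qed.

Lemma psi_plus_natural (f : ell A -> HC A Neg) (g : ell B -> HC B Neg)
    (fp : ell_plus A -> HC A Pos) (gp : ell_plus B -> HC B Pos) :
  is_psi f -> is_psi g -> is_psi_plus f fp -> is_psi_plus g gp ->
  forall x, hc_map h (fp x) = gp (plus_map h x).
Proof.
move=> fP gP [fD fM fg fv] [gD gM gg gv] x; have [t ->] := mclass_surj x.
elim: t => {x} [[a|i]||s IHs t IHt|a t IHt].
- have := hc_mapE h (fg a); rewrite cchain_map_single /word_map /=.
  by move/represents_unique; apply; rewrite plus_mapE; apply: gg.
- have := hc_mapE h (fv i); rewrite cchain_map_single /word_map /= rmorph1.
  by move/represents_unique; apply; rewrite plus_mapE; apply: gv.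
- rewrite -[mclass _ MZero]/(0 : ell_plus A).
  by rewrite (morph0 fD) !raddf0 (morph0 gD).
- by rewrite mclassD fD plus_mapD gD -IHs -IHt; apply: raddfD.
- rewrite mclassZ plus_mapZ; apply/esym; apply: hc_mul_map (fM _ _) _.
  by rewrite IHt (psi_natural fP gP); apply: gM.
Qed.

End PsiNaturality.

Section PieceLifts.
Variables (A B : gr_alg nat) (h : gr_alg_hom A B).
Hypothesis hsurj : forall y, exists x, h x = y.

Lemma pterm_hom_lift (X Y : Type) (R : term X -> term X -> Prop)
    (S : term Y -> term Y -> Prop) (m : {rmorphism presented R -> presented S})
    (I : nmodType) (gdeg : X -> I -> Prop) (gdeg' : Y -> I -> Prop) d y :
  (forall x d, gdeg' x d -> exists2 x', gdeg x' d & m (pgen R x') = pgen S x) ->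
  pterm_hom gdeg' d y -> exists2 x : presented R, pterm_hom gdeg d x & m x = y.
Proof.
move=> lift_gen; elim=> {d y}.
- move=> x d /lift_gen[x' dx' <-]; exists (pgen R x') => //; exact: phom_gen.
- by move=> d; exists 0; [apply: phom_zero | apply: raddf0].
- by exists 1; [apply: phom_one | apply: rmorph1].
- move=> d _ _ _ [x px <-] _ [y py <-].
  by exists (x + y); [apply: phom_add | apply: raddfD].
- move=> d d' _ _ _ [x px <-] _ [y py <-].
  by exists (x * y); [apply: phom_mul | apply: rmorphM].
Qed.

Lemma ell_piece_lift d (y : ell B) : ell_piece d y ->
  exists2 x : ell A, ell_piece d x & ell_map h x = y.
Proof.
apply: (pterm_hom_lift (m := ell_hom h)) => _ _ [s a pa|s a pa|s a pa|].
- have [x px <-] := surj_piece hsurj pa.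
  by exists (Delta x); [apply: deg_delta | exact: ell_mapE].
- have [x px <-] := surj_piece hsurj pa.
  by exists (Phi x); [apply: deg_phi | exact: ell_mapE].
- have [x px <-] := surj_piece hsurj pa.
  by exists (Qop x); [apply: deg_q | exact: ell_mapE].
- by exists Uop; [apply: deg_u | exact: ell_mapE].
Qed.

Lemma per_piece_lift d (y : ell_per B) : per_piece d y ->
  exists2 x : ell_per A, per_piece d x & per_map h x = y.
Proof.
apply: (pterm_hom_lift (m := per_hom h)) => _ _ [s a pa|s a pa||].
- have [x px <-] := surj_piece hsurj pa.
  by exists (PPhi x); [apply: deg_pphi | exact: per_mapE].
- have [x px <-] := surj_piece hsurj pa.
  by exists (PQop x); [apply: deg_pq | exact: per_mapE].
- by exists PUop; [apply: deg_pu | exact: per_mapE].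
- by exists PUinv; [apply: deg_puinv | exact: per_mapE].
Qed.

Lemma plus_piece_lift d (y : ell_plus B) : plus_piece d y ->
  exists2 x : ell_plus A, plus_piece d x & plus_map h x = y.
Proof.
elim=> {d y}.
- move=> _ _ [s a pa|i].
    have [x px <-] := surj_piece hsurj pa.
    by exists (plus_gamma x); [apply/mhom_gen/deg_gamma | exact: plus_mapE].
  by exists (plus_v A i); [apply/mhom_gen/deg_v | exact: plus_mapE].
- by move=> d; exists 0; [apply: mhom_zero | apply: raddf0].
- move=> d _ _ _ [x px <-] _ [y py <-].
  by exists (x + y); [apply: mhom_add | apply: raddfD].
- move=> d d' _ _ /ell_piece_lift[a pa <-] _ [x px <-].
  by exists (a *: x); [apply: mhom_scale | apply: plus_mapZ].
Qed.

End PieceLifts.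

Section Universality.
Variables (ungraded : bool) (G : zmodType) (tdeg : {additive (int * int)%type -> G}).
Implicit Types A B C : ft_alg ungraded.

Lemma ell_universal (F : alg_functor ungraded G) (f : forall A, F A -> HC A Neg)
    (psi : forall A, ell A -> HC A Neg) :
  (forall A, is_psi (@psi A)) -> is_alg_transf tdeg f -> alg_iso_on_polynomials tdeg f ->
  exists2 e : forall A, {rmorphism ell A -> F A},
    is_ell_transf tdeg e & forall A x, f A (e A x) = psi A x.
Proof.
move=> psiP fP f_iso.
have f_bij A : is_polynomial A -> bijective (f A) by case/f_iso.
have [|||||||||e [en epsi eE]] := @ring_descent ungraded Neg
  (fun A => ell A) (fun A => F A) (fun A B h => ell_hom h)
  (fun A B h => gah_fun (af_map F h)) psi f.
- by move=> A; apply: psi_hom.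
- exact: at_hom fP.
- by move=> A B h x; apply: psi_natural.
- by move=> A B h x; apply: (at_natural fP).
- exact: f_bij.
- by move=> A B C h k l x; apply: ell_map_comp.
- by move=> A B C h k l x lkh; apply: af_comp.
- by move=> n hn A h hsurj y; apply: ell_map_surj.
- by move=> n hn A h hsurj x y; apply: ell_map_ker.
exists e => //; split=> [A d y py|A B h x]; last exact: en.
have [n [hn [h hsurj]]] := free_cover A.
have [x px hx] := ell_piece_lift hsurj py.
have polP : is_polynomial (free_ft hn) by exact: free_is_polynomial.
have [g _ gK] := f_bij _ polP.
rewrite (eE _ _ (af_map F h (g (psi _ x)))); last first.
  by exists n, hn, h, x, (g (psi _ x)).
apply: gah_piece; apply: (f_iso _ polP).2; rewrite gK.
by apply: graded_class_piece; apply: psi_graded.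
Qed.

Lemma per_universal (F : alg_functor ungraded G) (f : forall A, F A -> HC A Per)
    (psi : forall A, ell_per A -> HC A Per) :
  (forall A, is_psi_per (@psi A)) -> is_alg_transf tdeg f -> alg_iso_on_polynomials tdeg f ->
  exists2 e : forall A, {rmorphism ell_per A -> F A},
    is_per_transf tdeg e & forall A x, f A (e A x) = psi A x.
Proof.
move=> psiP fP f_iso.
have f_bij A : is_polynomial A -> bijective (f A) by case/f_iso.
have [|||||||||e [en epsi eE]] := @ring_descent ungraded Per
  (fun A => ell_per A) (fun A => F A) (fun A B h => per_hom h)
  (fun A B h => gah_fun (af_map F h)) psi f.
- by move=> A; apply: psi_per_hom.
- exact: at_hom fP.
- by move=> A B h x; apply: psi_per_natural.
- by move=> A B h x; apply: (at_natural fP).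
- exact: f_bij.
- by move=> A B C h k l x; apply: per_map_comp.
- by move=> A B C h k l x lkh; apply: af_comp.
- by move=> n hn A h hsurj y; apply: per_map_surj.
- by move=> n hn A h hsurj x y; apply: per_map_ker.
exists e => //; split=> [A d y py|A B h x]; last exact: en.
have [n [hn [h hsurj]]] := free_cover A.
have [x px hx] := per_piece_lift hsurj py.
have polP : is_polynomial (free_ft hn) by exact: free_is_polynomial.
have [g _ gK] := f_bij _ polP.
rewrite (eE _ _ (af_map F h (g (psi _ x)))); last first.
  by exists n, hn, h, x, (g (psi _ x)).
apply: gah_piece; apply: (f_iso _ polP).2; rewrite gK.
by apply: graded_class_piece; apply: psi_per_graded.
Qed.

Lemma plus_universal (F : mod_functor ungraded G) (f : forall A, F A -> HC A Pos)
    (psi : forall A, ell A -> HC A Neg) (psip : forall A, ell_plus A -> HC A Pos) :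
  (forall A, is_psi (@psi A)) -> (forall A, is_psi_plus (@psi A) (@psip A)) ->
  is_mod_transf tdeg f -> mod_iso_on_polynomials tdeg f ->
  exists2 e : forall A, {additive ell_plus A -> F A},
    is_plus_transf tdeg e & forall A x, f A (e A x) = psip A x.
Proof.
move=> psiP psipP fP f_iso.
have f_bij A : is_polynomial A -> bijective (f A) by case/f_iso.
pose Lmap A B (h : gr_alg_hom A B) := plus_hom h.
pose Fmap A B (h : gr_alg_hom A B) : {additive F A -> F B} := mf_map F h.
have psipD A := psi_plus_add (psipP A).
have fD A := @mt_add _ _ _ _ _ _ fP A.
have psip_natural A B (h : gr_alg_hom A B) x :
    hc_map h (psip A x) = psip B (Lmap A B h x).
  exact: psi_plus_natural (psiP A) (psiP B) (psipP A) (psipP B) x.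
have f_natural A B (h : gr_alg_hom A B) x : f B (Fmap A B h x) = hc_map h (f A x).
  exact: (mt_natural fP).
have Lmap_comp A B C (h : gr_alg_hom A B) (k : gr_alg_hom B C) (l : gr_alg_hom A C) x :
    l =1 k \o h -> Lmap A C l x = Lmap B C k (Lmap A B h x).
  exact: plus_map_comp.
have Fmap_comp A B C (h : gr_alg_hom A B) (k : gr_alg_hom B C) (l : gr_alg_hom A C) x :
    l =1 k \o h -> Fmap A C l x = Fmap B C k (Fmap A B h x).
  by move=> lkh; apply: mf_comp.
have Lmap_surj n (hn : admissible ungraded n) A (h : gr_alg_hom (free_ft hn) A) :
    (forall y, exists x, h x = y) -> forall y, exists x, Lmap _ _ h x = y.
  by move=> hsurj y; apply: plus_map_surj.
have Lmap_ker n (hn : admissible ungraded n) A (h : gr_alg_hom (free_ft hn) A) :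
    (forall y, exists x, h x = y) -> forall x y, Lmap _ _ h x = Lmap _ _ h y ->
    coeq (fun A B h => Lmap A B h) h x y.
  by move=> hsurj x y; apply: plus_map_ker.
pose e A := @descent ungraded Pos (fun A => ell_plus A) (fun A => F A) Lmap Fmap psip f
  f_bij Lmap_surj A.
have eE A y z : lift_rel Lmap Fmap psip f y z -> e A y = z by apply: descentE.
have eB A : zmod_morphism (e A) by apply: descent_is_zmod_morphism.
exists (fun A => HB.pack_for {additive ell_plus A -> F A} (e A)
  (GRing.isZmodMorphism.Build _ _ (e A) (eB A))); last first.
  by move=> A x; apply: descent_psi.
split=> [A d y py|A B h x]; last exact: (@descent_natural _ _ _ _ Lmap Fmap).
have [n [hn [h hsurj]]] := free_cover A.
have [x px hx] := plus_piece_lift hsurj py.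
have polP : is_polynomial (free_ft hn) by exact: free_is_polynomial.
have [g _ gK] := f_bij _ polP.
rewrite /= (eE _ _ (mf_map F h (g (psip _ x)))); last first.
  by exists n, hn, h, x, (g (psip _ x)).
apply: gmh_piece; apply: (f_iso _ polP).2; rewrite gK.
apply: graded_class_piece; exact: psi_plus_graded (psiP _) (psipP _) px.
Qed.

End Universality.

Theorem corollary8p6
    (ungraded : bool)
    (G : zmodType) (tdeg : {additive (int * int)%type -> G})
    (psi : forall A : ft_alg ungraded, ell A -> HC A Neg)
    (psi_per : forall A : ft_alg ungraded, ell_per A -> HC A Per)
    (psi_plus : forall A : ft_alg ungraded, ell_plus A -> HC A Pos)
    (psiP : forall A : ft_alg ungraded, is_psi (psi A))
    (psi_perP : forall A : ft_alg ungraded, is_psi_per (psi_per A))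
    (psi_plusP : forall A : ft_alg ungraded, is_psi_plus (psi A) (psi_plus A))
    (F F_per : alg_functor ungraded G) (F_plus : mod_functor ungraded G)
    (f : forall A : ft_alg ungraded, F A -> HC A Neg)
    (f_per : forall A : ft_alg ungraded, F_per A -> HC A Per)
    (f_plus : forall A : ft_alg ungraded, F_plus A -> HC A Pos)
    (fP : is_alg_transf tdeg f)
    (f_perP : is_alg_transf tdeg f_per)
    (f_plusP : is_mod_transf tdeg f_plus)
    (f_iso : alg_iso_on_polynomials tdeg f)
    (f_per_iso : alg_iso_on_polynomials tdeg f_per)
    (f_plus_iso : mod_iso_on_polynomials tdeg f_plus) :
  exists (e : forall A : ft_alg ungraded, {rmorphism ell A -> F A})
         (e_per : forall A : ft_alg ungraded, {rmorphism ell_per A -> F_per A})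
         (e_plus : forall A : ft_alg ungraded, {additive ell_plus A -> F_plus A}),
    [/\ is_ell_transf tdeg e,
        is_per_transf tdeg e_per,
        is_plus_transf tdeg e_plus
      & [/\ forall (A : ft_alg ungraded) x, f A (e A x) = psi A x,
            forall (A : ft_alg ungraded) x, f_per A (e_per A x) = psi_per A x
          & forall (A : ft_alg ungraded) x, f_plus A (e_plus A x) = psi_plus A x]].
Proof.
have [e eP epsi] := ell_universal psiP fP f_iso.
have [e_per e_perP epsi_per] := per_universal psi_perP f_perP f_per_iso.
have [e_plus e_plusP epsi_plus] := plus_universal psiP psi_plusP f_plusP f_plus_iso.
by exists e, e_per, e_plus.
Qed.
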